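(* Let $\chi_1$ and $\chi_2$ be non-principal even primitive Dirichlet characters modulo $p$ and $q$ respectively, and let $a,x>0$ with $\frac{a^2 pq x}{16 \pi^2}\notin\mathbb{Z}_{>0}$. Then \begin{align*} \sum_{n=1}^\infty d_{\chi_1,\chi_2}(n) K_0(a\sqrt{nx})= \frac{a^2pq\, x}{32 \pi^4} \tau( \chi _1)\tau(\chi_2) \sum_{n=1}^\infty d_{\bar{\chi}_1,\bar{\chi}_2}(n) \frac{\log \left(\frac{16\pi^2 n}{a^2pqx} \right) }{n^2-\left(\frac{a^2pqx}{16\pi^2 } \right)^2}. \end{align*}
   Context: $d_{\chi_1,\chi_2}(n)=\sum_{d\mid n}\chi_1(d)\chi_2(n/d)$. $\tau(\chi)=\sum_{h=1}^q\chi(h)e^{2\pi i h/q}$ is the Gauss sum, and $K_0$ the modified Bessel function of the second kind of order $0$. *)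

(* Defs.v *)
From Stdlib Require Import Reals Lra Lia Arith.
From Coquelicot Require Import Coquelicot.
Open Scope R_scope.

(* A Dirichlet character modulo q (values in C, argument in nat; chi(-1) = chi(q-1)). *)
Definition dirichlet_char (q : nat) (chi : nat -> C) : Prop :=
  (1 <= q)%nat /\
  chi 1%nat = RtoC 1 /\
  (forall m n : nat, chi (m * n)%nat = (chi m * chi n)%C) /\
  (forall n : nat, chi (n + q)%nat = chi n) /\
  (forall n : nat, Nat.gcd n q <> 1%nat -> chi n = (RtoC 0)).

Definition principal (q : nat) (chi : nat -> C) : Prop :=
  forall n : nat, Nat.gcd n q = 1%nat -> chi n = RtoC 1.

Definition induced_modulus (q d : nat) (chi : nat -> C) : Prop :=
  forall n : nat, Nat.gcd n q = 1%nat -> n mod d = 1 mod d -> chi n = RtoC 1.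

Definition primitive_char (q : nat) (chi : nat -> C) : Prop :=
  dirichlet_char q chi /\
  forall d : nat, (1 <= d)%nat -> Nat.divide d q -> (d < q)%nat ->
    ~ induced_modulus q d chi.

(* even: chi(-1) = 1, with -1 represented by q - 1 *)
Definition even_char (q : nat) (chi : nat -> C) : Prop := chi (q - 1)%nat = RtoC 1.

Definition cexp_i (theta : R) : C := (cos theta, sin theta).

Definition gauss_sum (q : nat) (chi : nat -> C) : C :=
  sum_n_m (fun h : nat => (chi h * cexp_i (2 * PI * INR h / INR q))%C) 1 q.

Definition dchi (chi1 chi2 : nat -> C) (n : nat) : C :=
  sum_n_m (fun d : nat =>
             if Nat.eqb (n mod d) 0 then (chi1 d * chi2 (Nat.div n d))%C else (RtoC 0)) 1 n.

Definition conj_char (chi : nat -> C) : nat -> C := fun n => Cconj (chi n).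

(* Modified Bessel function of the second kind of order 0, for x > 0:
   K_0(x) = int_0^oo exp(-x cosh t) dt *)
Definition K0 (x : R) : R :=
  RInt_gen (fun t => exp (- x * cosh t)) (at_point 0) (Rbar_locally p_infty).

(* Main.v *)
(** Put c = a sqrt x / 2.  Both series are integrals over the real line:
    2 K_0(2c sqrt(mn)) is the integral of exp(-c m e^u) exp(-c n e^(-u)) du, and up to
    constants log(mn/beta) / ((mn)^2 - beta^2) is the integral of
    U(c e^u, m/p) U(c e^(-u), n/q) du with U(y, v) = 2y / (y^2 + 4 pi^2 v^2).
    Summed against an even primitive character the two kernels agree:
    sum chi(m) e^(-my) = (tau(chi)/q) sum conj(chi(k)) U(y, k/q).  Indeed both sides are
    combinations of values at v = h/q of the Poisson kernel sinh y / (cosh y - cos 2 pi v),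
    which is 1 + 2 sum e^(-my) cos(2 pi m v) and, by a Herglotz argument (both sides satisfy
    the same duplication formula and differ by O(y) as y -> 0), also sum U(y, v + j).
    The products of the kernels are O((mn)^(-3/2)) times an integrable weight in u, so
    truncating the double sums to mn <= N costs O(N^(-1/4)) after integration.  The truncated
    integrals are the partial sums of the two series, which therefore converge, with the
    stated relation between their limits. *)

Require Import Defs.
From Stdlib Require Import Reals Lra Lia Arith Classical.
From Coquelicot Require Import Coquelicot.
Open Scope R_scope.

(** * Finite complex sums *)

Definition csum (f : nat -> C) (n : nat) : C := sum_n_m f 1 n.

Lemma csum_O (f : nat -> C) : csum f 0 = RtoC 0.
Proof. apply (sum_n_m_zero (G := C_AbelianMonoid)). lia. Qed.

Lemma csum_S (f : nat -> C) (n : nat) : csum f (S n) = (csum f n + f (S n))%C.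
Proof. apply (sum_n_Sm (G := C_AbelianMonoid)). lia. Qed.

Lemma csum_succ_l (f : nat -> C) (n : nat) :
  csum f (S n) = (f 1%nat + csum (fun i => f (S i)) n)%C.
Proof. unfold csum. rewrite sum_n_m_S. apply (sum_Sn_m (G := C_AbelianMonoid)). lia. Qed.

Lemma csum_ext (f g : nat -> C) (n : nat) :
  (forall i, (1 <= i <= n)%nat -> f i = g i) -> csum f n = csum g n.
Proof. apply (sum_n_m_ext_loc (G := C_AbelianMonoid)). Qed.

Lemma csum_zero (f : nat -> C) (n : nat) :
  (forall i, (1 <= i <= n)%nat -> f i = RtoC 0) -> csum f n = RtoC 0.
Proof.
intros H. rewrite (csum_ext _ (fun _ => RtoC 0) n H).
apply (sum_n_m_const_zero (G := C_AbelianMonoid)).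
Qed.

Lemma csum_const (z : C) (n : nat) : csum (fun _ => z) n = (RtoC (INR n) * z)%C.
Proof.
induction n as [|n IH].
- rewrite csum_O. simpl. ring.
- rewrite csum_S, IH, S_INR, RtoC_plus. ring.
Qed.

Lemma csum_plus (f g : nat -> C) (n : nat) :
  csum (fun i => f i + g i)%C n = (csum f n + csum g n)%C.
Proof. apply (sum_n_m_plus (G := C_AbelianMonoid)). Qed.

Lemma csum_mult_l (c : C) (f : nat -> C) (n : nat) :
  csum (fun i => c * f i)%C n = (c * csum f n)%C.
Proof. apply (sum_n_m_mult_l (K := C_Ring)). Qed.

Lemma csum_mult_r (c : C) (f : nat -> C) (n : nat) :
  csum (fun i => f i * c)%C n = (csum f n * c)%C.
Proof. apply (sum_n_m_mult_r (K := C_Ring)). Qed.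

Lemma csum_minus (f g : nat -> C) (n : nat) :
  csum (fun i => f i - g i)%C n = (csum f n - csum g n)%C.
Proof.
replace (csum f n - csum g n)%C with (csum f n + RtoC (-1) * csum g n)%C by ring.
rewrite <- csum_mult_l, <- csum_plus. apply csum_ext. intros i _. ring.
Qed.

Lemma csum_swap (F : nat -> nat -> C) (m n : nat) :
  csum (fun i => csum (F i) n) m = csum (fun j => csum (fun i => F i j) m) n.
Proof.
induction m as [|m IH].
- rewrite csum_O. symmetry. apply csum_zero. intros j _. apply csum_O.
- rewrite csum_S, IH, <- csum_plus. apply csum_ext. intros j _. symmetry. apply csum_S.
Qed.

Lemma csum_RtoC (f : nat -> R) (n : nat) :
  csum (fun i => RtoC (f i)) n = RtoC (sum_n_m f 1 n).
Proof.
induction n as [|n IH].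
- now rewrite csum_O, sum_n_m_zero by lia.
- rewrite csum_S, IH, sum_n_Sm, <- RtoC_plus by lia. reflexivity.
Qed.

Lemma csum_single (f : nat -> C) (n k : nat) :
  (1 <= k <= n)%nat -> (forall i, (1 <= i <= n)%nat -> i <> k -> f i = RtoC 0) ->
  csum f n = f k.
Proof.
induction n as [|n IH]; intros Hk H; [lia|]. rewrite csum_S.
destruct (Nat.eq_dec k (S n)) as [->|Hn].
- rewrite csum_zero by (intros; apply H; lia). ring.
- rewrite IH by (try lia; intros; apply H; lia). rewrite (H (S n)) by lia. ring.
Qed.

Lemma csum_add (f : nat -> C) (m n : nat) :
  csum f (m + n) = (csum f m + csum (fun i => f (m + i)%nat) n)%C.
Proof.
induction n as [|n IH].
- rewrite Nat.add_0_r, csum_O. ring.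
- rewrite Nat.add_succ_r, !csum_S, IH, Nat.add_succ_r. ring.
Qed.

Lemma csum_extend (f : nat -> C) (n m : nat) :
  (n <= m)%nat -> (forall i, (n < i <= m)%nat -> f i = RtoC 0) -> csum f m = csum f n.
Proof.
intros H Hf. replace m with (n + (m - n))%nat by lia.
rewrite csum_add, (csum_zero _ (m - n)) by (intros; apply Hf; lia). ring.
Qed.

Lemma csum_blocks (f : nat -> C) (q k : nat) :
  csum f (q * k) = csum (fun h => csum (fun j => f (h + (j - 1) * q)%nat) k) q.
Proof.
rewrite <- csum_swap. induction k as [|k IH].
- now rewrite Nat.mul_0_r, !csum_O.
- rewrite Nat.mul_succ_r, csum_add, IH, csum_S. f_equal.
  apply csum_ext. intros h _. f_equal. lia.
Qed.

Lemma csum_reflect (f : nat -> C) (n : nat) :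
  f 0%nat = f n -> csum (fun i => f (n - i)%nat) n = csum f n.
Proof.
assert (H : (csum (fun i => f (n - i)%nat) n + f n = csum f n + f 0%nat)%C).
{ induction n as [|n IH].
  - rewrite !csum_O. ring.
  - rewrite csum_succ_l, csum_S. replace (S n - 1)%nat with n by lia.
    rewrite (csum_ext _ (fun i => f (n - i)%nat)) by (intros; reflexivity).
    rewrite (Cplus_comm (f n)), IH. ring. }
intros E. rewrite E in H.
replace (csum (fun i => f (n - i)%nat) n)
  with (csum (fun i => f (n - i)%nat) n + f n - f n)%C by ring.
rewrite H. ring.
Qed.

Lemma Cmod_csum_le (f : nat -> C) (g : nat -> R) (B : R) (n : nat) :
  (forall i, (1 <= i <= n)%nat -> Cmod (f i) <= B * g i) ->
  Cmod (csum f n) <= B * sum_n_m g 1 n.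
Proof.
induction n as [|n IH]; intros H.
- rewrite csum_O, Cmod_0, sum_n_m_zero by lia. unfold zero; simpl. lra.
- rewrite csum_S, sum_n_Sm by lia. unfold plus; simpl. rewrite Rmult_plus_distr_l.
  eapply Rle_trans; [apply Cmod_triangle|].
  apply Rplus_le_compat; [apply IH; intros; apply H; lia|apply H; lia].
Qed.

(** * Limits of complex sequences *)

Definition is_lim_seq_C (u : nat -> C) (l : C) : Prop := filterlim u eventually (locally l).

Lemma is_lim_seq_C_Cmod (u : nat -> C) (l : C) :
  is_lim_seq_C u l <-> is_lim_seq (fun n => Cmod (u n - l)) 0.
Proof.
unfold is_lim_seq_C. rewrite (filterlim_locally_ball_norm (U := C_NormedModule)).
rewrite <- is_lim_seq_spec.
split; intros H eps; destruct (H eps) as [N HN]; exists N; intros n Hn; specialize (HN n Hn).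
- now rewrite Rminus_0_r, Rabs_pos_eq by apply Cmod_ge_0.
- rewrite Rminus_0_r, Rabs_pos_eq in HN by apply Cmod_ge_0. exact HN.
Qed.

Lemma is_lim_seq_C_squeeze (u : nat -> C) (l : C) (e : nat -> R) :
  (forall n, Cmod (u n - l) <= e n) -> is_lim_seq e 0 -> is_lim_seq_C u l.
Proof.
intros H He. apply is_lim_seq_C_Cmod.
apply (is_lim_seq_le_le (fun _ => 0) _ e 0); [|apply is_lim_seq_const|exact He].
intros n. split; [apply Cmod_ge_0|apply H].
Qed.

Lemma is_lim_seq_C_ext (u v : nat -> C) (l : C) :
  (forall n, u n = v n) -> is_lim_seq_C u l -> is_lim_seq_C v l.
Proof. intros E. apply filterlim_ext, E. Qed.

Lemma is_lim_seq_C_const (l : C) : is_lim_seq_C (fun _ => l) l.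
Proof. apply filterlim_const. Qed.

Lemma is_lim_seq_C_plus (u v : nat -> C) (l m : C) :
  is_lim_seq_C u l -> is_lim_seq_C v m -> is_lim_seq_C (fun n => u n + v n)%C (l + m)%C.
Proof.
intros Hu Hv. apply (filterlim_comp_2 _ _ Cplus Hu Hv (filterlim_plus (V := C_NormedModule) l m)).
Qed.

Lemma is_lim_seq_C_mult (u v : nat -> C) (l m : C) :
  is_lim_seq_C u l -> is_lim_seq_C v m -> is_lim_seq_C (fun n => u n * v n)%C (l * m)%C.
Proof.
assert (HC : forall w z, is_lim_seq_C w z <->
    filterlim w eventually (locally (T := AbsRing_UniformSpace C_AbsRing) z)).
{ intros w z. split; intros H P HP; apply H, locally_C, HP. }
rewrite !HC. intros Hu Hv.
apply (filterlim_comp_2 _ _ Cmult Hu Hv (filterlim_mult (K := C_AbsRing) l m)).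
Qed.

Lemma is_lim_seq_C_RtoC (u : nat -> R) (l : R) :
  is_lim_seq u l -> is_lim_seq_C (fun n => RtoC (u n)) (RtoC l).
Proof.
intros H. apply is_lim_seq_C_Cmod.
apply (is_lim_seq_ext (fun n => Rabs (u n - l))).
- intros n. now rewrite <- RtoC_minus, Cmod_R.
- rewrite <- is_lim_seq_abs_0. replace (Finite 0) with (Finite (l - l)) by (f_equal; ring).
  apply is_lim_seq_minus'; [exact H|apply is_lim_seq_const].
Qed.

Lemma is_lim_seq_C_csum (u : nat -> nat -> C) (l : nat -> C) (n : nat) :
  (forall i, (1 <= i <= n)%nat -> is_lim_seq_C (fun k => u k i) (l i)) ->
  is_lim_seq_C (fun k => csum (u k) n) (csum l n).
Proof.
induction n as [|n IH]; intros H.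
- apply is_lim_seq_C_ext with (fun _ => csum l 0); [|apply is_lim_seq_C_const].
  intros k. now rewrite !csum_O.
- rewrite csum_S. apply is_lim_seq_C_ext with (fun k => (csum (u k) n + u k (S n))%C).
  + intros k. now rewrite csum_S.
  + apply is_lim_seq_C_plus; [apply IH; intros; apply H; lia|apply H; lia].
Qed.

Lemma Cmod_lim_le (u : nat -> C) (l z : C) (B : R) :
  is_lim_seq_C u l -> eventually (fun k => Cmod (u k - z) <= B) -> Cmod (l - z) <= B.
Proof.
intros Hu H. apply is_lim_seq_C_Cmod in Hu. rewrite <- (Rplus_0_l B).
apply (is_lim_seq_le_loc (fun _ => Cmod (l - z)) (fun k => Cmod (u k - l) + B)
         (Cmod (l - z)) (0 + B)).
- revert H. apply filter_imp. intros k Hk.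
  replace (l - z)%C with (- (u k - l) + (u k - z))%C by ring.
  eapply Rle_trans; [apply Cmod_triangle|]. rewrite Cmod_opp. lra.
- apply is_lim_seq_const.
- apply is_lim_seq_plus'; [exact Hu|apply is_lim_seq_const].
Qed.

Lemma is_lim_seq_C_cauchy (u : nat -> C) (e : nat -> R) :
  (forall n m, Cmod (u n - u m) <= e n + e m) -> is_lim_seq e 0 ->
  exists l, is_lim_seq_C u l.
Proof.
intros H He. apply (filterlim_locally_cauchy (U := C_CompleteNormedModule)). intros eps.
apply is_lim_seq_spec in He. destruct (He (pos_div_2 eps)) as [N HN].
exists (fun n => (N <= n)%nat). split; [now exists N|]. intros n m Hn Hm.
apply C_NormedModule_mixin_compat1. eapply Rle_lt_trans; [apply H|].
pose proof (HN n Hn) as Bn. pose proof (HN m Hm) as Bm. simpl in Bn, Bm.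
apply Rabs_def2 in Bn. apply Rabs_def2 in Bm. lra.
Qed.

Lemma is_series_csum_scal (z l : C) (f g : nat -> C) :
  is_lim_seq_C (csum g) l -> (forall n, (1 <= n)%nat -> f n = (z * g n)%C) ->
  is_series (fun n => f (S n)) (z * l)%C.
Proof.
intros H E. apply (filterlim_ext (fun n => z * csum g (S n))%C).
- intros n. rewrite <- csum_mult_l, <- (csum_ext f) by (intros; apply E; lia).
  symmetry. apply (sum_n_m_S (G := C_AbelianMonoid) f 0 n).
- apply (is_lim_seq_C_mult _ _ _ _ (is_lim_seq_C_const z)).
  apply (filterlim_comp _ _ _ S _ _ eventually); [apply eventually_subseq; lia|exact H].
Qed.

(** * Sums over residue classes *)

Lemma periodic_mod {A : Type} (q : nat) (f : nat -> A) (n : nat) :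
  (1 <= q)%nat -> (forall m, f (m + q)%nat = f m) -> f (n mod q) = f n.
Proof.
intros Hq Hf. rewrite (Nat.div_mod n q) at 2 by lia.
induction (n / q)%nat as [|k IH].
- now rewrite Nat.mul_0_r.
- rewrite IH, <- Hf. f_equal. lia.
Qed.

Lemma mod_inverse_exists (q n : nat) :
  Nat.gcd n q = 1%nat -> exists m, ((n * m) mod q = 1 mod q)%nat.
Proof.
intros Hg. destruct n as [|n].
- rewrite Nat.gcd_0_l in Hg. subst q. now exists 0%nat.
- destruct (Nat.gcd_bezout_pos (S n) q ltac:(lia)) as [a [b E]].
  exists a. rewrite Nat.mul_comm, E, Hg. apply Nat.Div0.mod_add.
Qed.

Lemma csum_residue (q x : nat) (f : nat -> C) :
  (1 <= q)%nat -> (forall m, f (m + q)%nat = f m) ->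
  csum (fun l => if l mod q =? x mod q then f l else RtoC 0) q = f x.
Proof.
intros Hq Hf. pose proof (Nat.mod_upper_bound x q ltac:(lia)) as Hx.
set (r := if x mod q =? 0 then q else x mod q).
assert (Hr : (1 <= r <= q)%nat /\ r mod q = x mod q).
{ unfold r. destruct (Nat.eqb_spec (x mod q) 0) as [E|E].
  - rewrite E, Nat.Div0.mod_same. lia.
  - rewrite Nat.Div0.mod_mod. lia. }
destruct Hr as [Hr Er]. rewrite (csum_single _ q r Hr).
- rewrite Er, Nat.eqb_refl, <- (periodic_mod q f r Hq Hf), Er. now apply periodic_mod.
- intros i Hi Hne. destruct (Nat.eqb_spec (i mod q) (x mod q)) as [E|E]; [|reflexivity].
  exfalso. apply Hne. unfold r.
  destruct (Nat.eq_dec i q) as [->|Hiq].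
  + now rewrite <- E, Nat.Div0.mod_same.
  + rewrite <- E, (Nat.mod_small i q) by lia.
    now rewrite (proj2 (Nat.eqb_neq i 0)) by lia.
Qed.

Lemma csum_mul_coprime (q n : nat) (f : nat -> C) :
  (1 <= q)%nat -> Nat.gcd n q = 1%nat -> (forall m, f (m + q)%nat = f m) ->
  csum (fun m => f (m * n)%nat) q = csum f q.
Proof.
intros Hq Hn Hf. destruct (mod_inverse_exists q n Hn) as [n' En].
assert (Hcancel : forall x, ((x * (n * n')) mod q = x mod q)%nat).
{ intros x. rewrite <- Nat.Div0.mul_mod_idemp_r, En.
  now rewrite Nat.Div0.mul_mod_idemp_r, Nat.mul_1_r. }
assert (Hinv : forall l m, (l mod q =? (m * n) mod q) = (m mod q =? (l * n') mod q)).
{ intros l m. apply Bool.eq_iff_eq_true. rewrite !Nat.eqb_eq. split; intros E.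
  - now rewrite <- Nat.Div0.mul_mod_idemp_l, E, Nat.Div0.mul_mod_idemp_l,
      <- Nat.mul_assoc, Hcancel.
  - now rewrite <- Nat.Div0.mul_mod_idemp_l, E, Nat.Div0.mul_mod_idemp_l,
      <- Nat.mul_assoc, (Nat.mul_comm n'), Hcancel. }
rewrite (csum_ext _ (fun m =>
  csum (fun l => if l mod q =? (m * n) mod q then f l else RtoC 0) q)).
2:{ intros m _. symmetry. now apply csum_residue. }
rewrite csum_swap. apply csum_ext. intros l _.
rewrite (csum_ext _ (fun m => if m mod q =? (l * n') mod q then f l else RtoC 0)).
- now apply (csum_residue q (l * n') (fun _ => f l)).
- intros m _. now rewrite Hinv.
Qed.

(** * Dirichlet characters and Gauss sums *)

Definition unit_root (q k : nat) : C := cexp_i (2 * PI * INR k / INR q).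

Lemma cexp_i_add (s t : R) : cexp_i (s + t) = (cexp_i s * cexp_i t)%C.
Proof.
unfold cexp_i, Cmult; simpl. rewrite cos_plus, sin_plus. f_equal; ring.
Qed.

Lemma cexp_i_period (t : R) (k : nat) : cexp_i (t + 2 * INR k * PI) = cexp_i t.
Proof. unfold cexp_i. now rewrite cos_period, sin_period. Qed.

Lemma cexp_i_opp (t : R) : cexp_i (- t) = Cconj (cexp_i t).
Proof. unfold cexp_i, Cconj; simpl. now rewrite cos_neg, sin_neg. Qed.

Lemma unit_root_add (q j k : nat) :
  unit_root q (j + k) = (unit_root q j * unit_root q k)%C.
Proof.
unfold unit_root. rewrite <- cexp_i_add, plus_INR. f_equal. unfold Rdiv; ring.
Qed.

Lemma unit_root_0 (q : nat) : unit_root q 0 = RtoC 1.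
Proof.
unfold unit_root, cexp_i, RtoC. simpl. unfold Rdiv.
now rewrite Rmult_0_r, Rmult_0_l, cos_0, sin_0.
Qed.

Lemma unit_root_period (q k j : nat) :
  (1 <= q)%nat -> unit_root q (k + j * q) = unit_root q k.
Proof.
intros Hq. unfold unit_root. rewrite <- (cexp_i_period (2 * PI * INR k / INR q) j). f_equal.
rewrite plus_INR, mult_INR. field. apply not_0_INR. lia.
Qed.

Lemma unit_root_neg (q k j : nat) :
  (k <= q)%nat -> (1 <= q)%nat -> unit_root q ((q - k) * j) = Cconj (unit_root q (k * j)).
Proof.
intros Hk Hq. unfold unit_root. rewrite <- cexp_i_opp, <- (cexp_i_period (- _) j). f_equal.
rewrite !mult_INR, minus_INR by exact Hk. field. apply not_0_INR. lia.
Qed.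

Lemma unit_root_neq_1 (q k : nat) :
  (1 <= q)%nat -> k mod q <> 0%nat -> unit_root q k <> RtoC 1.
Proof.
intros Hq Hk.
rewrite <- (periodic_mod q (unit_root q) k Hq).
2:{ intros m. replace (m + q)%nat with (m + 1 * q)%nat by lia. now apply unit_root_period. }
pose proof (Nat.mod_upper_bound k q ltac:(lia)) as Hkq.
set (r := (k mod q)%nat) in *. intros E.
unfold unit_root, cexp_i, RtoC in E. injection E as Ecos _.
assert (Hq0 : 0 < INR q) by (apply lt_0_INR; lia).
assert (Hr0 : 0 < INR r) by (apply lt_0_INR; lia).
assert (Hrq : INR r < INR q) by (apply lt_INR; lia).
set (t := PI * (INR r / INR q)).
assert (Ht : 0 < t < PI).
{ assert (0 < INR r / INR q < 1).
  { split; [now apply Rdiv_lt_0_compat|]. apply (Rdiv_lt_1 _ _ Hq0), Hrq. }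
  pose proof PI_RGT_0. unfold t. nra. }
pose proof (sin_gt_0 t (proj1 Ht) (proj2 Ht)).
replace (2 * PI * INR r / INR q) with (2 * t) in Ecos by (unfold t; field; lra).
rewrite cos_2a_sin in Ecos. nra.
Qed.

Lemma Cmult_fixed_eq_0 (z x : C) : z <> RtoC 1 -> x = (z * x)%C -> x = RtoC 0.
Proof.
intros Hz E. destruct (classic (x = RtoC 0)) as [H|H]; [exact H|exfalso].
apply Hz. replace z with (z * x / x)%C by (field; exact H). rewrite <- E. field. exact H.
Qed.

Lemma csum_unit_root (q k : nat) :
  (1 <= q)%nat ->
  csum (fun h => unit_root q (h * k)) q
  = if (k mod q =? 0)%nat then RtoC (INR q) else RtoC 0.
Proof.
intros Hq. destruct (Nat.eqb_spec (k mod q) 0) as [E|E].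
- apply Nat.Div0.mod_divides in E. destruct E as [d ->].
  rewrite (csum_ext _ (fun _ => RtoC 1)).
  + rewrite csum_const. ring.
  + intros h _. replace (h * (q * d))%nat with (0 + h * d * q)%nat by ring.
    rewrite unit_root_period by exact Hq. apply unit_root_0.
- apply (Cmult_fixed_eq_0 (unit_root q k)); [now apply unit_root_neq_1|].
  rewrite <- csum_mult_l.
  rewrite (csum_ext (fun h => _ * _)%C (fun h => unit_root q (S h * k))).
  2:{ intros h _. simpl. now rewrite unit_root_add. }
  pose proof (csum_succ_l (fun h => unit_root q (h * k)) q) as H. rewrite csum_S in H.
  replace (S q * k)%nat with (1 * k + k * q)%nat in H by lia.
  rewrite unit_root_period in H by exact Hq.
  apply (f_equal (fun z => z - unit_root q (1 * k))%C) in H.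
  ring_simplify in H. exact H.
Qed.

Lemma Cconj_RtoC (x : R) : Cconj (RtoC x) = RtoC x.
Proof. unfold Cconj, RtoC; simpl. now rewrite Ropp_0. Qed.

Lemma dirichlet_char_conj (q : nat) (chi : nat -> C) :
  dirichlet_char q chi -> dirichlet_char q (conj_char chi).
Proof.
intros [Hq [H1 [Hm [Hp H0]]]]. unfold conj_char. repeat split.
- exact Hq.
- now rewrite H1, Cconj_RtoC.
- intros m n. now rewrite Hm, Cmult_conj.
- intros n. now rewrite Hp.
- intros n Hn. now rewrite (H0 n Hn), Cconj_RtoC.
Qed.

Lemma Cconj_eq_1 (z : C) : Cconj z = RtoC 1 <-> z = RtoC 1.
Proof.
destruct z as [a b]. unfold Cconj, RtoC; simpl.
split; intros E; injection E as -> E; f_equal; lra.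
Qed.

Lemma primitive_char_conj (q : nat) (chi : nat -> C) :
  primitive_char q chi -> primitive_char q (conj_char chi).
Proof.
intros [Hc Hprim]. split; [now apply dirichlet_char_conj|].
intros d Hd Hdq Hlt Hind. apply (Hprim d Hd Hdq Hlt).
intros n Hn En. apply Cconj_eq_1. now apply Hind.
Qed.

Lemma even_char_conj (q : nat) (chi : nat -> C) :
  even_char q chi -> even_char q (conj_char chi).
Proof. intros H. now apply Cconj_eq_1. Qed.

Section DirichletCharacter.

Variables (q : nat) (chi : nat -> C).
Hypothesis chi_char : dirichlet_char q chi.

Lemma char_modulus_pos : (1 <= q)%nat.
Proof. apply chi_char. Qed.

Lemma char_1 : chi 1%nat = RtoC 1.
Proof. apply chi_char. Qed.

Lemma char_mul (m n : nat) : chi (m * n)%nat = (chi m * chi n)%C.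
Proof. apply chi_char. Qed.

Lemma char_eq_0 (n : nat) : Nat.gcd n q <> 1%nat -> chi n = RtoC 0.
Proof. apply chi_char. Qed.

Lemma char_mod (n : nat) : chi (n mod q) = chi n.
Proof. apply periodic_mod; apply chi_char. Qed.

Lemma char_add_mul (n k : nat) : chi (n + k * q)%nat = chi n.
Proof. rewrite <- char_mod, Nat.Div0.mod_add. apply char_mod. Qed.

Lemma char_modulus : chi q = chi 0%nat.
Proof. rewrite <- (char_add_mul 0 1). f_equal. lia. Qed.

Lemma char_0 : (1 < q)%nat -> chi 0%nat = RtoC 0.
Proof. intros Hq. apply char_eq_0. rewrite Nat.gcd_0_l. lia. Qed.

Lemma nonprincipal_modulus_gt_1 : ~ principal q chi -> (1 < q)%nat.
Proof.
intros Hn. pose proof char_modulus_pos. destruct (Nat.eq_dec q 1) as [E|E]; [exfalso|lia].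
apply Hn. intros n _. rewrite <- char_1, <- (char_mod n), <- (char_mod 1), E.
now rewrite !Nat.mod_1_r.
Qed.

Lemma char_pow (n k : nat) : chi (n ^ k)%nat = (chi n ^ k)%C.
Proof.
induction k as [|k IH]; simpl.
- exact char_1.
- now rewrite char_mul, IH.
Qed.

Lemma char_bounded : exists B, forall n, Cmod (chi n) <= B.
Proof.
assert (H : forall m, exists B, forall n, (n < m)%nat -> Cmod (chi n) <= B).
{ induction m as [|m [B IH]].
  - exists 0. intros; lia.
  - exists (Rmax B (Cmod (chi m))). intros n Hn.
    destruct (Nat.eq_dec n m) as [->|E]; [apply Rmax_r|].
    eapply Rle_trans; [apply IH; lia|apply Rmax_l]. }
destruct (H q) as [B HB]. exists B. intros n. pose proof char_modulus_pos.
rewrite <- char_mod. apply HB, Nat.mod_upper_bound. lia.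
Qed.

(* The powers of chi n are values of chi, hence bounded. *)
Lemma char_Cmod_le_1 (n : nat) : Cmod (chi n) <= 1.
Proof.
destruct char_bounded as [B HB].
destruct (Rle_lt_dec (Cmod (chi n)) 1) as [H|H]; [exact H|exfalso].
assert (Habs : Rabs (Cmod (chi n)) > 1) by (rewrite Rabs_pos_eq; [lra|apply Cmod_ge_0]).
destruct (Pow_x_infinity _ Habs (B + 1)) as [N HN]. specialize (HN N (le_n _)).
rewrite <- Cmod_pow, <- char_pow, Rabs_pos_eq in HN by apply Cmod_ge_0.
pose proof (HB (n ^ N)%nat). lra.
Qed.

Lemma char_mul_conj (n : nat) : Nat.gcd n q = 1%nat -> (chi n * Cconj (chi n))%C = RtoC 1.
Proof.
intros Hg. rewrite <- Cmod2_conj.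
destruct (mod_inverse_exists q n Hg) as [m Em].
assert (E : Cmod (chi n) * Cmod (chi m) = 1).
{ now rewrite <- Cmod_mult, <- char_mul, <- char_mod, Em, char_mod, char_1, Cmod_1. }
pose proof (char_Cmod_le_1 m). pose proof (char_Cmod_le_1 n).
pose proof (Cmod_ge_0 (chi n)). pose proof (Cmod_ge_0 (chi m)).
replace (Cmod (chi n)) with 1 by nra. f_equal. ring.
Qed.

Lemma even_char_reflect (h : nat) :
  even_char q chi -> (h <= q)%nat -> chi (q - h)%nat = chi h.
Proof.
intros He Hh. pose proof char_modulus_pos. destruct h as [|h].
- rewrite Nat.sub_0_r. exact char_modulus.
- rewrite <- (char_add_mul _ h).
  replace (q - S h + h * q)%nat with ((q - 1) * S h)%nat by nia.
  rewrite char_mul, He. ring.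
Qed.

Lemma gauss_sum_twist_coprime (k : nat) :
  Nat.gcd k q = 1%nat ->
  csum (fun h => chi h * unit_root q (h * k))%C q = (Cconj (chi k) * gauss_sum q chi)%C.
Proof.
intros Hk. pose proof char_modulus_pos as Hq.
change (gauss_sum q chi) with (csum (fun h => chi h * unit_root q h)%C q).
rewrite <- (csum_mul_coprime q k (fun h => chi h * unit_root q h)%C Hq Hk).
- rewrite <- csum_mult_l. apply csum_ext. intros h _. rewrite char_mul.
  replace (Cconj (chi k) * (chi h * chi k * unit_root q (h * k)))%C
    with ((chi k * Cconj (chi k)) * (chi h * unit_root q (h * k)))%C by ring.
  rewrite char_mul_conj by exact Hk. ring.
- intros m. replace (m + q)%nat with (m + 1 * q)%nat by lia.
  now rewrite char_add_mul, unit_root_period.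
Qed.

End DirichletCharacter.

(* The quotient q / gcd k q is a proper divisor of q, so chi n <> 1 for some n = 1 modulo it. *)
Lemma primitive_char_nontrivial (q : nat) (chi : nat -> C) (k : nat) :
  primitive_char q chi -> Nat.gcd k q <> 1%nat ->
  exists n, Nat.gcd n q = 1%nat /\ chi n <> RtoC 1 /\ exists r, (n * k = k + r * q)%nat.
Proof.
intros [Hc Hprim] Hk. pose proof (char_modulus_pos q chi Hc) as Hq.
destruct (Nat.gcd_divide k q) as [[k' Ek] [d Ed]]. set (e := Nat.gcd k q) in *.
assert (He : (1 < e)%nat) by (destruct e as [|[|e]]; lia).
assert (Hd : (1 <= d)%nat) by (destruct d; lia).
assert (Hni : ~ induced_modulus q d chi).
{ apply Hprim; [exact Hd|exists e; lia|nia]. }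
apply not_all_ex_not in Hni. destruct Hni as [n Hn].
apply imply_to_and in Hn. destruct Hn as [Hg Hn].
apply imply_to_and in Hn. destruct Hn as [Hmod Hne].
exists n. split; [exact Hg|split; [exact Hne|]].
assert (Hn1 : (1 <= n)%nat) by (destruct n; [rewrite Nat.gcd_0_l in Hg|]; lia).
destruct (proj1 (Nat.Div0.mod_divides (n - 1) d)) as [t Et].
{ pose proof (Nat.div_mod n d ltac:(lia)) as En. rewrite Hmod in En.
  destruct (Nat.eq_dec d 1) as [->|Hd1]; [apply Nat.mod_1_r|].
  rewrite (Nat.mod_small 1 d) in En by lia.
  replace (n - 1)%nat with (n / d * d)%nat by lia. apply Nat.Div0.mod_mul. }
exists (t * k')%nat. replace n with (1 + d * t)%nat by lia.
rewrite Ek, Ed. ring.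
Qed.

Section PrimitiveCharacter.

Variables (q : nat) (chi : nat -> C).
Hypothesis chi_primitive : primitive_char q chi.

Lemma gauss_sum_twist (k : nat) :
  csum (fun h => chi h * unit_root q (h * k))%C q = (Cconj (chi k) * gauss_sum q chi)%C.
Proof.
destruct chi_primitive as [Hc _]. pose proof (char_modulus_pos q chi Hc) as Hq.
destruct (Nat.eq_dec (Nat.gcd k q) 1) as [Hk|Hk]; [now apply gauss_sum_twist_coprime|].
replace (Cconj (chi k)) with (RtoC 0).
2:{ rewrite (char_eq_0 q chi Hc k Hk). symmetry. apply Cconj_RtoC. }
rewrite Cmult_0_l.
destruct (primitive_char_nontrivial q chi k chi_primitive Hk) as [n [Hn [Hne [r Er]]]].
apply (Cmult_fixed_eq_0 (chi n) _ Hne).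
rewrite <- (csum_mul_coprime q n (fun h => chi h * unit_root q (h * k))%C Hq Hn) at 1.
- rewrite <- csum_mult_l. apply csum_ext. intros h _.
  replace (h * n * k)%nat with (h * k + h * r * q)%nat
    by (rewrite <- (Nat.mul_assoc h n k), Er; ring).
  rewrite (char_mul q), unit_root_period by assumption. ring.
- intros m. replace ((m + q) * k)%nat with (m * k + k * q)%nat by ring.
  replace (m + q)%nat with (m + 1 * q)%nat by lia.
  now rewrite (char_add_mul q), unit_root_period.
Qed.

Lemma csum_primitive_char : (1 < q)%nat -> csum chi q = RtoC 0.
Proof.
intros Hq. transitivity (csum (fun h => chi h * unit_root q (h * 0))%C q).
- apply csum_ext. intros h _. rewrite Nat.mul_0_r, unit_root_0. ring.
- rewrite (gauss_sum_twist 0), (char_0 q) by (exact Hq || apply chi_primitive).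
  rewrite Cconj_RtoC. apply Cmult_0_l.
Qed.

Lemma gauss_sum_mul_conj :
  (1 < q)%nat ->
  (gauss_sum q chi * gauss_sum q (conj_char chi))%C = (chi (q - 1)%nat * RtoC (INR q))%C.
Proof.
intros Hq.
change (gauss_sum q (conj_char chi)) with (csum (fun h => Cconj (chi h) * unit_root q h)%C q).
rewrite <- csum_mult_l.
rewrite (csum_ext _ (fun h => csum (fun m => chi m * unit_root q (h * (m + 1))) q)%C).
2:{ intros h _.
    replace (gauss_sum q chi * (Cconj (chi h) * unit_root q h))%C
      with (Cconj (chi h) * gauss_sum q chi * unit_root q h)%C by ring.
    rewrite <- gauss_sum_twist, <- csum_mult_r. apply csum_ext. intros m _.
    replace (h * (m + 1))%nat with (m * h + h)%nat by ring. rewrite unit_root_add. ring. }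
rewrite csum_swap, (csum_single _ q (q - 1)).
- rewrite csum_mult_l, csum_unit_root by lia.
  replace (q - 1 + 1)%nat with q by lia. now rewrite Nat.Div0.mod_same.
- lia.
- intros m Hm Hne. rewrite csum_mult_l, csum_unit_root by lia.
  destruct (Nat.eqb_spec ((m + 1) mod q) 0) as [E|E]; [exfalso|ring].
  apply Nat.Div0.mod_divides in E. destruct E as [[|[|c]] E]; nia.
Qed.

Lemma even_char_csum_cos (m : nat) :
  even_char q chi ->
  csum (fun h => chi h * RtoC (cos (2 * PI * (INR h / INR q) * INR m)))%C q
  = (Cconj (chi m) * gauss_sum q chi)%C.
Proof.
intros He. destruct chi_primitive as [Hc _]. pose proof (char_modulus_pos q chi Hc) as Hq.
assert (Hrefl : csum (fun h => chi h * Cconj (unit_root q (h * m)))%C q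
                = csum (fun h => chi h * unit_root q (h * m))%C q).
{ rewrite <- (csum_reflect (fun h => chi h * unit_root q (h * m))%C).
  - apply csum_ext. intros h Hh.
    now rewrite (even_char_reflect q), unit_root_neg by (assumption || lia).
  - rewrite (char_modulus q), (Nat.mul_comm q m), Nat.mul_0_l by exact Hc.
    now rewrite <- (unit_root_period q 0 m Hq). }
rewrite <- gauss_sum_twist.
transitivity (RtoC (/ 2) * (csum (fun h => chi h * unit_root q (h * m)) q
                    + csum (fun h => chi h * Cconj (unit_root q (h * m))) q))%C.
- rewrite <- csum_plus, <- csum_mult_l. apply csum_ext. intros h _.
  replace (cos (2 * PI * (INR h / INR q) * INR m)) with (Re (unit_root q (h * m))).
  + rewrite re_alt, RtoC_inv by lra. unfold Cdiv. ring.
  + unfold unit_root, cexp_i. simpl. f_equal. rewrite mult_INR. unfold Rdiv. ring.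
- rewrite Hrefl, RtoC_inv by lra. field.
Qed.

End PrimitiveCharacter.

(** * Real powers and series *)

Lemma Rpower_pos (x s : R) : 0 < Rpower x s.
Proof. apply exp_pos. Qed.

Lemma Rpower_1_l (s : R) : Rpower 1 s = 1.
Proof. unfold Rpower. rewrite ln_1, Rmult_0_r. apply exp_0. Qed.

Lemma Rpower_Ropp_le (a b s : R) :
  0 <= s -> 0 < a <= b -> Rpower b (- s) <= Rpower a (- s).
Proof.
intros Hs Hab. rewrite !Rpower_Ropp.
apply Rinv_le_contravar; [apply Rpower_pos|now apply Rle_Rpower_l].
Qed.

Lemma ln_le_minus_1 (x : R) : 0 < x -> ln x <= x - 1.
Proof. intros Hx. pose proof (exp_ineq1_le (ln x)) as H. rewrite exp_ln in H; lra. Qed.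

Lemma Rpower_scal_exp (c u a : R) : 0 < c -> Rpower (c * exp u) a = Rpower c a * exp (a * u).
Proof.
intros Hc. rewrite <- Rpower_mult_distr by (exact Hc || apply exp_pos).
unfold Rpower at 2. now rewrite ln_exp.
Qed.

Lemma exp_neg_le_Rpower (s z : R) :
  0 < s -> 0 < z -> exp (- z) <= Rpower s s * Rpower z (- s).
Proof.
intros Hs Hz. unfold Rpower. rewrite <- exp_plus.
assert (Hzs : 0 < z / s) by now apply Rdiv_lt_0_compat.
pose proof (ln_le_minus_1 _ Hzs) as Hln. rewrite ln_div in Hln by assumption.
apply (Rmult_le_compat_l s) in Hln; [|lra].
replace (s * (z / s - 1)) with (z - s) in Hln by (field; lra).
left. apply exp_increasing. lra.
Qed.

Lemma Rpower_mul_le_add_sq (x y t : R) :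
  0 < x -> 0 < y -> 0 <= t <= 2 -> Rpower x t * Rpower y (2 - t) <= x ^ 2 + y ^ 2.
Proof.
intros Hx Hy Ht. pose proof (pow_lt x 2 Hx). pose proof (pow_lt y 2 Hy).
assert (Esq : forall z, 0 < z -> Rpower z t * Rpower z (2 - t) = z ^ 2).
{ intros z Hz. rewrite <- Rpower_plus, <- Rpower_pow by exact Hz. f_equal. simpl. ring. }
destruct (Rle_lt_dec x y) as [Hxy|Hxy].
- apply Rle_trans with (Rpower y t * Rpower y (2 - t)); [|rewrite Esq; lra].
  apply Rmult_le_compat_r; [left; apply Rpower_pos|apply Rle_Rpower_l; lra].
- apply Rle_trans with (Rpower x t * Rpower x (2 - t)); [|rewrite Esq; lra].
  apply Rmult_le_compat_l; [left; apply Rpower_pos|apply Rle_Rpower_l; lra].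
Qed.

Lemma is_lim_exp_scal_m (k : R) : 0 < k -> is_lim (fun u => exp (k * u)) m_infty 0.
Proof.
intros Hk. apply (filterlim_comp _ _ _ (fun u => k * u) exp _ (Rbar_locally m_infty));
  [|exact is_lim_exp_m].
intros P [M HM]. exists (M / k). intros u Hu. apply HM. apply Rlt_div_r in Hu; lra.
Qed.

Lemma is_lim_exp_scal_p (k : R) : k < 0 -> is_lim (fun u => exp (k * u)) p_infty 0.
Proof.
intros Hk. apply (filterlim_comp _ _ _ (fun u => k * u) exp _ (Rbar_locally m_infty));
  [|exact is_lim_exp_m].
intros P [M HM]. exists (- M / - k). intros u Hu. apply HM. apply Rlt_div_l in Hu; lra.
Qed.

Lemma is_lim_seq_Rpower_Ropp (s : R) :
  0 < s -> is_lim_seq (fun N => Rpower (INR (S N)) (- s)) 0.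
Proof.
intros Hs. apply (is_lim_seq_incr_1 (fun N => Rpower (INR N) (- s))).
apply (is_lim_comp_seq (fun u => exp (- s * u)) (fun N => ln (INR N)) p_infty 0).
- apply is_lim_exp_scal_p. lra.
- exists 0%nat. intros; discriminate.
- apply (is_lim_comp_seq ln INR p_infty p_infty).
  + exact is_lim_ln_p.
  + exists 0%nat. intros; discriminate.
  + exact is_lim_seq_INR.
Qed.

Lemma Rpower_telescope (s x : R) :
  1 < s -> 0 < x ->
  (s - 1) * Rpower (x + 1) (- s) <= Rpower x (1 - s) - Rpower (x + 1) (1 - s).
Proof.
intros Hs Hx. set (z := x / (x + 1)).
assert (Hz : 0 < z) by (apply Rdiv_lt_0_compat; lra).
assert (Ex : Rpower x (1 - s) = Rpower (x + 1) (1 - s) * Rpower z (1 - s)).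
{ rewrite Rpower_mult_distr by lra. f_equal. unfold z. field. lra. }
assert (Hbern : 1 + (s - 1) * / (x + 1) <= Rpower z (1 - s)).
{ eapply Rle_trans; [|apply exp_ineq1_le]. apply Rplus_le_compat_l.
  pose proof (ln_le_minus_1 z Hz) as Hln.
  replace (z - 1) with (- / (x + 1)) in Hln by (unfold z; field; lra).
  assert (0 <= (s - 1) * (- / (x + 1) - ln z)) by (apply Rmult_le_pos; lra). lra. }
replace (Rpower (x + 1) (- s)) with (Rpower (x + 1) (1 - s) * / (x + 1)).
2:{ rewrite <- (Rpower_1 (x + 1)) at 2 by lra. rewrite <- Rpower_Ropp, <- Rpower_plus.
    f_equal. ring. }
rewrite Ex.
apply (Rmult_le_compat_l (Rpower (x + 1) (1 - s))) in Hbern; [lra|].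
left. apply Rpower_pos.
Qed.

Lemma sum_Rpower_le (s : R) (n : nat) :
  1 < s -> sum_n_m (fun k => Rpower (INR k) (- s)) 1 n <= s / (s - 1).
Proof.
intros Hs. destruct n as [|n].
- rewrite sum_n_m_zero by lia. left. apply Rdiv_lt_0_compat; lra.
- apply Rle_trans with ((s - Rpower (INR (S n)) (1 - s)) / (s - 1)).
  + induction n as [|n IH].
    * rewrite sum_n_n. change (INR 1) with 1. rewrite !Rpower_1_l. right. field. lra.
    * rewrite sum_n_Sm by lia. eapply Rle_trans; [apply Rplus_le_compat_r, IH|].
      pose proof (Rpower_telescope s (INR (S n)) Hs (lt_0_INR _ (Nat.lt_0_succ n))) as H.
      rewrite (S_INR (S n)). apply Rmult_le_reg_r with (s - 1); [lra|].
      field_simplify; lra.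
  + apply Rmult_le_compat_r; [left; apply Rinv_0_lt_compat; lra|].
    pose proof (Rpower_pos (INR (S n)) (1 - s)). lra.
Qed.

Lemma is_lim_seq_scal_0 (c : R) (u : nat -> R) :
  is_lim_seq u 0 -> is_lim_seq (fun n => c * u n) 0.
Proof.
intros H. replace (Finite 0) with (Rbar_mult c 0) by (simpl; f_equal; ring).
now apply is_lim_seq_scal_l.
Qed.

Lemma series_nonneg_bounded (a : nat -> R) (M : R) :
  (forall n, 0 <= a n) -> (forall n, sum_n a n <= M) -> ex_series a /\ 0 <= Series a <= M.
Proof.
intros Ha HM.
assert (Hincr : forall n, sum_n a n <= sum_n a (S n)).
{ intros n. rewrite sum_Sn. specialize (Ha (S n)). unfold plus; simpl. lra. }
destruct (ex_finite_lim_seq_incr _ M Hincr HM) as [l Hl].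
assert (Hs : is_series a l) by exact Hl.
split; [now exists l|]. rewrite (is_series_unique _ _ Hs). split.
- apply Rle_trans with (sum_n a 0); [rewrite sum_O; apply Ha|].
  now apply (is_lim_seq_incr_compare _ _ Hl).
- exact (is_lim_seq_le _ (fun _ => M) l M HM Hl (is_lim_seq_const M)).
Qed.

Lemma Series_even_odd (f : nat -> R) :
  ex_series f -> ex_series (fun j => f (2 * j)%nat) -> ex_series (fun j => f (2 * j + 1)%nat) ->
  Series (fun j => f (2 * j)%nat) + Series (fun j => f (2 * j + 1)%nat) = Series f.
Proof.
intros Hf Heven Hodd. rewrite <- Series_plus by assumption.
apply is_series_unique.
assert (E : forall n, sum_n (fun j => f (2 * j)%nat + f (2 * j + 1)%nat) n
                     = sum_n f (2 * n + 1)).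
{ induction n as [|n IH].
  - simpl. now rewrite sum_Sn, !sum_O.
  - rewrite sum_Sn, IH. replace (2 * S n + 1)%nat with (S (S (2 * n + 1))) by lia.
    rewrite !sum_Sn. replace (2 * S n)%nat with (S (2 * n + 1)) by lia.
    unfold plus; simpl. ring. }
apply (is_lim_seq_ext (fun n => sum_n f (2 * n + 1)) _ (Series f)); [intros; symmetry; apply E|].
apply (is_lim_seq_subseq (sum_n f) _ (fun n => (2 * n + 1)%nat)).
- apply eventually_subseq. intros; lia.
- exact (Series_correct f Hf).
Qed.

(** * Partial fractions of the Poisson kernel *)

Definition poisson_kernel (y v : R) : R := sinh y / (cosh y - cos (2 * PI * v)).

Definition cauchy_kernel (y v : R) : R := 2 * y / (y ^ 2 + (2 * PI * v) ^ 2).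

Definition cauchy_series (y v : R) : R := Series (fun j => cauchy_kernel y (INR j + v)).

Lemma sinh_pos (y : R) : 0 < y -> 0 < sinh y.
Proof. intros Hy. rewrite <- sinh_0. now apply sinh_lt. Qed.

Lemma cosh_sq (y : R) : cosh y ^ 2 = 1 + sinh y ^ 2.
Proof. unfold cosh, sinh. rewrite exp_Ropp. field. apply Rgt_not_eq, exp_pos. Qed.

Lemma sinh_double (y : R) : sinh (2 * y) = 2 * sinh y * cosh y.
Proof.
unfold cosh, sinh. replace (2 * y) with (y + y) by ring. rewrite !exp_Ropp, exp_plus.
field. apply Rgt_not_eq, exp_pos.
Qed.

Lemma cosh_double (y : R) : cosh (2 * y) = 1 + 2 * sinh y ^ 2.
Proof.
unfold cosh, sinh. replace (2 * y) with (y + y) by ring. rewrite !exp_Ropp, exp_plus.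
field. apply Rgt_not_eq, exp_pos.
Qed.

Lemma cosh_ge_1 (y : R) : 1 <= cosh y.
Proof.
pose proof (cosh_sq y). pose proof (pow2_ge_0 (sinh y)).
assert (0 < cosh y) by (unfold cosh; pose proof (exp_pos y); pose proof (exp_pos (- y)); lra).
nra.
Qed.

Lemma cosh_gt_1 (y : R) : 0 < y -> 1 < cosh y.
Proof.
intros Hy. pose proof (cosh_sq y). pose proof (sinh_pos y Hy). pose proof (cosh_ge_1 y). nra.
Qed.

Lemma is_derive_sinh (x : R) : is_derive sinh x (cosh x).
Proof. apply is_derive_Reals, derivable_pt_lim_sinh. Qed.

Lemma is_derive_cosh (x : R) : is_derive cosh x (sinh x).
Proof. apply is_derive_Reals, derivable_pt_lim_cosh. Qed.

Lemma derive_nonneg_le (f df : R -> R) (a b : R) :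
  a <= b -> (forall x, a <= x <= b -> is_derive f x (df x)) ->
  (forall x, a <= x <= b -> 0 <= df x) -> f a <= f b.
Proof.
intros Hab Hd Hp.
destruct (MVT_gen f a b df) as [c [Hc E]]; rewrite ?Rmin_left, ?Rmax_right in * by lra.
- intros t Ht. apply Hd; lra.
- intros t Ht. apply derivable_continuous_pt. exists (df t). now apply is_derive_Reals, Hd.
- specialize (Hp c Hc). nra.
Qed.

Lemma sinh_ge_id (y : R) : 0 <= y -> y <= sinh y.
Proof.
intros Hy. apply Rminus_le_0.
replace 0 with (sinh 0 - 0) by (rewrite sinh_0; ring).
apply (derive_nonneg_le (fun x => sinh x - x) (fun x => cosh x - 1)); [exact Hy| |].
- intros x _. apply (is_derive_minus sinh (fun x => x)); [apply is_derive_sinh|apply @is_derive_id].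
- intros x _. pose proof (cosh_ge_1 x). lra.
Qed.

Lemma sinh_le_mul_cosh (y : R) : 0 <= y -> sinh y <= y * cosh y.
Proof.
intros Hy. apply Rminus_le_0.
replace 0 with (0 * cosh 0 - sinh 0) by (rewrite sinh_0; ring).
apply (derive_nonneg_le (fun x => x * cosh x - sinh x) (fun x => x * sinh x)); [exact Hy| |].
- intros x _. replace (x * sinh x) with (1 * cosh x + x * sinh x - cosh x) by ring.
  apply (is_derive_minus (fun x => x * cosh x) sinh); [|apply is_derive_sinh].
  apply (is_derive_mult (fun x => x) cosh).
  + apply @is_derive_id.
  + apply is_derive_cosh.
  + intros; apply Rmult_comm.
- intros x Hx. pose proof (sinh_ge_id x (proj1 Hx)). nra.
Qed.

(* [cosh y = 1 + 2 sinh^2 (y/2)] and [sinh z <= z cosh z] bound [cosh y] by itself. *)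
Lemma cosh_le (y : R) : 0 <= y <= 1 -> cosh y <= 1 + y ^ 2.
Proof.
intros Hy. set (z := y / 2).
assert (Hz : sinh z ^ 2 <= (z * cosh z) ^ 2).
{ apply pow_incr. split.
  - eapply Rle_trans; [|apply sinh_ge_id]; unfold z; lra.
  - apply sinh_le_mul_cosh. unfold z; lra. }
pose proof (cosh_double z) as E. pose proof (cosh_sq z) as Esq.
replace (2 * z) with y in E by (unfold z; field).
rewrite Rpow_mult_distr, Esq in Hz. unfold z in *.
assert (0 <= y ^ 2 <= 1) by nra. nra.
Qed.

Lemma sinh_cubic_bounds (y : R) : 0 <= y <= 1 -> y <= sinh y <= y + y ^ 3.
Proof.
intros Hy. split; [now apply sinh_ge_id|].
pose proof (sinh_le_mul_cosh y (proj1 Hy)). pose proof (cosh_le y Hy). nra.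
Qed.

Lemma sin_cubic_bounds (x : R) : 0 <= x <= 4 -> x - x ^ 3 / 6 <= sin x <= x.
Proof.
intros Hx. split.
- destruct (pre_sin_bound x 0 (proj1 Hx) (proj2 Hx)) as [H _].
  eapply Rle_trans; [|exact H]. right. unfold sin_approx, sin_term. simpl. field.
- destruct (Rle_lt_or_eq_dec 0 x (proj1 Hx)) as [H|<-]; [left; now apply sin_lt_x|].
  rewrite sin_0. lra.
Qed.

Lemma sinh_sq_add_sin_sq_near (y t : R) :
  0 <= y <= 1 -> 0 <= t <= 2 ->
  (y ^ 2 + t ^ 2) / 9 <= sinh y ^ 2 + sin t ^ 2 /\
  Rabs (y ^ 2 + t ^ 2 - (sinh y ^ 2 + sin t ^ 2)) <= 3 * (y ^ 2 + t ^ 2) ^ 2.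
Proof.
intros Hy Ht. pose proof (sinh_cubic_bounds y Hy) as Hsinh.
pose proof (sin_cubic_bounds t ltac:(lra)) as Hsin.
set (sh := sinh y) in *. set (si := sin t) in *.
assert (Hsi : t / 3 <= si) by nra.
assert (Hy2 : 0 <= y ^ 2 <= 1) by nra. assert (Ht2 : 0 <= t ^ 2) by nra.
assert (Hsh2 : y ^ 2 <= sh ^ 2 <= y ^ 2 + 3 * (y ^ 2) ^ 2).
{ split; [apply pow_incr; lra|].
  apply Rle_trans with ((y + y ^ 3) ^ 2); [apply pow_incr; lra|].
  replace ((y + y ^ 3) ^ 2) with (y ^ 2 + 2 * (y ^ 2) ^ 2 + y ^ 2 * (y ^ 2) ^ 2) by ring. nra. }
assert (Hsi2 : t ^ 2 - (t ^ 2) ^ 2 / 3 <= si ^ 2 <= t ^ 2).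
{ split; [|apply pow_incr; lra].
  assert (0 <= t * (t - si)) by nra.
  assert ((t - si) * (t + si) <= t ^ 3 / 6 * (2 * t)) by (apply Rmult_le_compat; lra). nra. }
split.
- assert ((t / 3) ^ 2 <= si ^ 2) by (apply pow_incr; lra). nra.
- apply Rabs_le. nra.
Qed.

Lemma poisson_kernel_half_angle (y v : R) :
  poisson_kernel y v = sinh y / (2 * (sinh (y / 2) ^ 2 + sin (PI * v) ^ 2)).
Proof.
unfold poisson_kernel. f_equal.
replace y with (2 * (y / 2)) at 1 by field. replace (2 * PI * v) with (2 * (PI * v)) by ring.
rewrite cosh_double, cos_2a_sin. ring.
Qed.

Lemma poisson_kernel_near_cauchy_kernel (y v : R) :
  0 < y <= 1 -> 0 <= v <= 1 / 2 -> Rabs (poisson_kernel y v - cauchy_kernel y v) <= 32 * y.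
Proof.
intros Hy Hv.
assert (Ht : 0 <= PI * v <= 2) by (pose proof PI_4; pose proof PI_RGT_0; nra).
destruct (sinh_sq_add_sin_sq_near (y / 2) (PI * v) ltac:(lra) Ht) as [HD HDQ].
pose proof (sinh_cubic_bounds y ltac:(lra)) as Hsinh.
rewrite poisson_kernel_half_angle.
replace (cauchy_kernel y v) with (y / (2 * ((y / 2) ^ 2 + (PI * v) ^ 2))).
2:{ unfold cauchy_kernel. field. nra. }
set (D := sinh (y / 2) ^ 2 + sin (PI * v) ^ 2) in *. set (Q := (y / 2) ^ 2 + (PI * v) ^ 2) in *.
assert (HQ : y ^ 2 / 4 <= Q) by (unfold Q; nra).
assert (HQ0 : 0 < Q) by nra. assert (HD0 : 0 < D) by lra.
replace (sinh y / (2 * D) - y / (2 * Q))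
  with ((sinh y - y) / (2 * D) + y * (Q - D) / (2 * D * Q)) by (field; lra).
replace (32 * y) with (18 * y + 14 * y) by ring.
eapply Rle_trans; [apply Rabs_triang|apply Rplus_le_compat].
- rewrite Rabs_pos_eq by (apply Rdiv_le_0_compat; lra).
  apply Rle_div_l; [lra|].
  assert (0 <= y ^ 3) by (apply pow_le; lra).
  assert (y ^ 3 <= 18 * y * (2 * (y ^ 2 / 36))) by lra.
  nra.
- rewrite Rabs_div, (Rabs_mult y), (Rabs_pos_eq y), (Rabs_pos_eq (2 * D * Q)) by nra.
  apply Rle_div_l; [nra|].
  assert (y * Rabs (Q - D) <= y * (3 * Q ^ 2)) by (apply Rmult_le_compat_l; lra).
  assert (Q / 9 * Q <= D * Q) by (apply Rmult_le_compat_r; lra). nra.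
Qed.

Lemma poisson_kernel_reflect (y v : R) : poisson_kernel y (1 - v) = poisson_kernel y v.
Proof.
unfold poisson_kernel.
replace (2 * PI * (1 - v)) with (- (2 * PI * v) + 2 * INR 1 * PI) by (simpl; ring).
now rewrite cos_period, cos_neg.
Qed.

Lemma poisson_kernel_double (y v : R) :
  0 < y ->
  poisson_kernel y (v / 2) + poisson_kernel y ((v + 1) / 2) = 2 * poisson_kernel (2 * y) v.
Proof.
intros Hy. unfold poisson_kernel.
replace (2 * PI * (v / 2)) with (PI * v) by field.
replace (2 * PI * ((v + 1) / 2)) with (PI * v + PI) by field.
replace (2 * PI * v) with (2 * (PI * v)) by ring.
pose proof (cosh_gt_1 y Hy). pose proof (COS_bound (PI * v)).
replace (cosh (2 * y)) with (2 * cosh y ^ 2 - 1) by (rewrite cosh_double, cosh_sq; ring).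
rewrite neg_cos, sinh_double, cos_2a_cos. field. repeat split; nra.
Qed.

Lemma cauchy_kernel_pos (y v : R) : 0 < y -> 0 < cauchy_kernel y v.
Proof.
intros Hy. apply Rdiv_lt_0_compat; [lra|].
pose proof (pow2_ge_0 (2 * PI * v)). pose proof (pow_lt y 2 Hy). lra.
Qed.

Lemma cauchy_kernel_le (t y v : R) :
  0 <= t <= 2 -> 0 < y -> 0 < v ->
  cauchy_kernel y v <= 2 * Rpower y (1 - t) * Rpower v (- (2 - t)).
Proof.
intros Ht Hy Hv. unfold cauchy_kernel. set (w := 2 * PI * v).
assert (Hw : v <= w) by (unfold w; pose proof PI2_1; nra).
apply Rle_trans with (2 * Rpower y (1 - t) * Rpower w (- (2 - t))).
- replace (2 * Rpower y (1 - t) * Rpower w (- (2 - t)))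
    with (2 * y / (Rpower y t * Rpower w (2 - t))).
  + apply Rmult_le_compat_l; [lra|]. apply Rinv_le_contravar.
    * apply Rmult_lt_0_compat; apply Rpower_pos.
    * apply Rpower_mul_le_add_sq; lra.
  + unfold Rminus at 2. rewrite Rpower_plus, !Rpower_Ropp, Rpower_1 by exact Hy.
    field. split; apply Rgt_not_eq, Rpower_pos.
- pose proof (Rpower_pos y (1 - t)). apply Rmult_le_compat_l; [lra|].
  apply Rpower_Ropp_le; lra.
Qed.

Lemma cauchy_series_tail (y v : R) :
  0 < y -> 0 <= v ->
  ex_series (fun j => cauchy_kernel y (INR (S j) + v)) /\
  0 <= Series (fun j => cauchy_kernel y (INR (S j) + v)) <= 4 * y.
Proof.
intros Hy Hv. apply series_nonneg_bounded; [intros; left; now apply cauchy_kernel_pos|].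
assert (Hterm : forall j,
  cauchy_kernel y (INR (S j) + v) <= 2 * y * Rpower (INR (S j)) (- (2))).
{ intros j. assert (HS : 0 < INR (S j)) by (apply lt_0_INR; lia).
  eapply Rle_trans; [apply (cauchy_kernel_le 0); lra|].
  rewrite !Rminus_0_r, Rpower_1 by exact Hy.
  apply Rmult_le_compat_l; [lra|]. apply Rpower_Ropp_le; lra. }
intros n. eapply Rle_trans; [apply (sum_n_m_le _ _ 0 n Hterm)|].
rewrite (sum_n_m_mult_l (K := R_Ring) (2 * y) (fun j => Rpower (INR (S j)) (- (2)))).
rewrite (sum_n_m_S (fun k => Rpower (INR k) (- (2)))). unfold mult; simpl.
pose proof (sum_Rpower_le 2 (S n) ltac:(lra)). nra.
Qed.

Lemma ex_series_cauchy_kernel (y v : R) :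
  0 < y -> 0 <= v -> ex_series (fun j => cauchy_kernel y (INR j + v)).
Proof. intros Hy Hv. apply ex_series_incr_1. now apply cauchy_series_tail. Qed.

Lemma cauchy_series_bounds (y v : R) :
  0 < y -> 0 <= v -> cauchy_kernel y v <= cauchy_series y v <= cauchy_kernel y v + 4 * y.
Proof.
intros Hy Hv. unfold cauchy_series. rewrite Series_incr_1 by now apply ex_series_cauchy_kernel.
change (INR 0) with 0. rewrite Rplus_0_l.
destruct (cauchy_series_tail y v Hy Hv) as [_ H]. lra.
Qed.

Lemma cauchy_kernel_double (y v : R) :
  0 < y -> cauchy_kernel y (v / 2) = 2 * cauchy_kernel (2 * y) v.
Proof.
intros Hy. unfold cauchy_kernel. pose proof (pow2_ge_0 (2 * PI * v)). pose proof (pow_lt y 2 Hy).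
field. repeat split; nra.
Qed.

Lemma cauchy_series_double (y v : R) :
  0 < y -> 0 <= v ->
  cauchy_series y (v / 2) + cauchy_series y ((v + 1) / 2) = 2 * cauchy_series (2 * y) v.
Proof.
intros Hy Hv.
assert (Eeven : forall j, cauchy_kernel y (INR j + v / 2)
                          = 2 * cauchy_kernel (2 * y) (INR (2 * j) + v)).
{ intros j. rewrite <- cauchy_kernel_double by exact Hy. f_equal.
  rewrite mult_INR. simpl. field. }
assert (Eodd : forall j, cauchy_kernel y (INR j + (v + 1) / 2)
                         = 2 * cauchy_kernel (2 * y) (INR (2 * j + 1) + v)).
{ intros j. rewrite <- cauchy_kernel_double by exact Hy. f_equal.
  rewrite plus_INR, mult_INR. simpl. field. }
unfold cauchy_series. rewrite (Series_ext _ _ Eeven), (Series_ext _ _ Eodd), <- Series_scal_l.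
apply (Series_even_odd (fun i => 2 * cauchy_kernel (2 * y) (INR i + v))).
- apply (ex_series_scal (K := R_AbsRing) (V := R_NormedModule) 2).
  apply ex_series_cauchy_kernel; lra.
- apply (ex_series_ext _ _ Eeven), ex_series_cauchy_kernel; lra.
- apply (ex_series_ext _ _ Eodd), ex_series_cauchy_kernel; lra.
Qed.

Definition poisson_defect (y v : R) : R :=
  poisson_kernel y v - cauchy_series y v - cauchy_series y (1 - v).

Lemma poisson_defect_reflect (y v : R) : poisson_defect y (1 - v) = poisson_defect y v.
Proof.
unfold poisson_defect. rewrite poisson_kernel_reflect.
replace (1 - (1 - v)) with v by ring. ring.
Qed.

Lemma poisson_defect_le (y v : R) :
  0 < y <= 1 -> 0 <= v <= 1 -> Rabs (poisson_defect y v) <= 42 * y.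
Proof.
assert (H : forall v, 0 < y <= 1 -> 0 <= v <= 1 / 2 -> Rabs (poisson_defect y v) <= 42 * y).
{ clear v. intros v Hy Hv. unfold poisson_defect.
  pose proof (poisson_kernel_near_cauchy_kernel y v Hy Hv) as Hnear.
  apply Rabs_le_between in Hnear.
  pose proof (cauchy_series_bounds y v ltac:(lra) ltac:(lra)).
  pose proof (cauchy_series_bounds y (1 - v) ltac:(lra) ltac:(lra)).
  pose proof (cauchy_kernel_pos y (1 - v) ltac:(lra)).
  assert (cauchy_kernel y (1 - v) <= y).
  { assert (H4 : 2 ^ 2 <= (2 * PI * (1 - v)) ^ 2) by (apply pow_incr; pose proof PI2_1; nra).
    pose proof (pow2_ge_0 y). unfold cauchy_kernel. apply Rle_div_l; nra. }
  apply Rabs_le. lra. }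
intros Hy Hv. destruct (Rle_dec v (1 / 2)) as [L|L]; [apply H; lra|].
rewrite <- poisson_defect_reflect. apply H; lra.
Qed.

Lemma poisson_defect_double (y v : R) :
  0 < y -> 0 <= v <= 1 ->
  poisson_defect y (v / 2) + poisson_defect y ((v + 1) / 2) = 2 * poisson_defect (2 * y) v.
Proof.
intros Hy Hv. unfold poisson_defect.
pose proof (poisson_kernel_double y v Hy).
pose proof (cauchy_series_double y v Hy ltac:(lra)).
pose proof (cauchy_series_double y (1 - v) Hy ltac:(lra)) as E.
replace ((1 - v) / 2) with (1 - (v + 1) / 2) in E by field.
replace ((1 - v + 1) / 2) with (1 - v / 2) in E by field. lra.
Qed.

Lemma poisson_defect_le_pow2 (k : nat) (y B : R) :
  0 < y -> (forall v, 0 <= v <= 1 -> Rabs (poisson_defect y v) <= B) ->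
  forall v, 0 <= v <= 1 -> Rabs (poisson_defect (2 ^ k * y) v) <= B.
Proof.
revert y. induction k as [|k IH]; intros y Hy HB v Hv.
- rewrite Rmult_1_l. now apply HB.
- replace (2 ^ S k * y) with (2 ^ k * (2 * y)) by (simpl; ring).
  apply IH; [lra| |exact Hv]. clear v Hv. intros v Hv.
  pose proof (poisson_defect_double y v Hy Hv).
  pose proof (HB (v / 2) ltac:(lra)) as Heven. pose proof (HB ((v + 1) / 2) ltac:(lra)) as Hodd.
  apply Rabs_le_between in Heven. apply Rabs_le_between in Hodd. apply Rabs_le. lra.
Qed.

(* Herglotz: the doubling formula carries the bound O(y / 2^k) on the defect at y / 2^k
   back to y. *)
Lemma poisson_kernel_partial_fractions (y v : R) :
  0 < y -> 0 <= v <= 1 -> poisson_kernel y v = cauchy_series y v + cauchy_series y (1 - v).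
Proof.
intros Hy Hv.
assert (Hpow : forall k, 0 < (/ 2) ^ k) by (intros; apply pow_lt; lra).
assert (Hlim : forall c, is_lim_seq (fun k => c * (/ 2) ^ k) 0).
{ intros c. apply is_lim_seq_scal_0, is_lim_seq_geom. rewrite Rabs_pos_eq; lra. }
assert (Hzero : Rabs (poisson_defect y v) <= 0).
{ apply (is_lim_seq_le_loc (fun _ => Rabs (poisson_defect y v)) (fun k => 42 * y * (/ 2) ^ k)
           (Rabs (poisson_defect y v)) 0); [|apply is_lim_seq_const|apply Hlim].
  destruct (proj2 (is_lim_seq_spec _ _) (Hlim y) (mkposreal 1 Rlt_0_1)) as [N HN].
  exists N. intros k Hk. specialize (HN k Hk). simpl in HN. apply Rabs_def2 in HN.
  specialize (Hpow k).
  replace y with (2 ^ k * (y * (/ 2) ^ k)) at 1 by (rewrite pow_inv; field; apply pow_nonzero; lra).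
  apply poisson_defect_le_pow2; [nra| |exact Hv].
  intros w Hw. rewrite Rmult_assoc. apply poisson_defect_le; [nra|exact Hw]. }
pose proof (Rle_abs (poisson_defect y v)). pose proof (Rabs_maj2 (poisson_defect y v)).
unfold poisson_defect in *. lra.
Qed.

(** * Character twists of the exponential and Cauchy kernels *)

Lemma exp_neg_INR_mult (n : nat) (y : R) : exp (- (INR n * y)) = exp (- y) ^ n.
Proof.
rewrite <- Rpower_pow by apply exp_pos. unfold Rpower. rewrite ln_exp. f_equal. ring.
Qed.

Lemma sum_pow_cos (r t : R) (n : nat) :
  (1 - 2 * r * cos t + r ^ 2) * sum_n_m (fun m => r ^ m * cos (t * INR m)) 1 n
  = r * cos t - r ^ 2 - (r ^ S n * cos (t * INR (S n)) - r ^ S (S n) * cos (t * INR n)).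
Proof.
assert (Hcos : forall m, cos (t * INR (S (S m))) + cos (t * INR m)
                         = 2 * cos t * cos (t * INR (S m))).
{ intros m. rewrite !S_INR.
  replace (t * (INR m + 1 + 1)) with (t * (INR m + 1) + t) by ring.
  replace (t * INR m) with (t * (INR m + 1) - t) by ring.
  rewrite cos_plus, cos_minus. ring. }
induction n as [|n IH].
- rewrite sum_n_m_zero by lia. unfold zero; simpl.
  rewrite !Rmult_0_r, !Rmult_1_r, cos_0. ring.
- rewrite sum_n_Sm by lia. unfold plus; simpl plus. rewrite Rmult_plus_distr_l, IH.
  replace (cos (t * INR (S (S n)))) with (2 * cos t * cos (t * INR (S n)) - cos (t * INR n))
    by (rewrite <- Hcos; ring).
  simpl. ring.
Qed.

Lemma is_lim_seq_pow_mult_bounded (r : R) (u : nat -> R) :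
  0 <= r < 1 -> (forall n, Rabs (u n) <= 1) -> is_lim_seq (fun n => r ^ n * u n) 0.
Proof.
intros Hr Hu. apply is_lim_seq_abs_0.
apply (is_lim_seq_le_le (fun _ => 0) _ (fun n => r ^ n)).
- intros n. pose proof (pow_le r n (proj1 Hr)) as Hn. specialize (Hu n).
  pose proof (Rabs_pos (u n)). rewrite Rabs_mult, (Rabs_pos_eq (r ^ n)) by exact Hn. nra.
- apply is_lim_seq_const.
- apply is_lim_seq_geom. rewrite Rabs_pos_eq; lra.
Qed.

Lemma is_lim_seq_sum_pow_cos (r t : R) :
  0 <= r < 1 ->
  is_lim_seq (sum_n_m (fun m => r ^ m * cos (t * INR m)) 1)
             ((r * cos t - r ^ 2) / (1 - 2 * r * cos t + r ^ 2)).
Proof.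
intros Hr. set (D := 1 - 2 * r * cos t + r ^ 2).
assert (HD : 0 < D) by (unfold D; pose proof (COS_bound t); nra).
assert (Hcos : forall s, Rabs (cos s) <= 1) by (intros s; apply Rabs_le, COS_bound).
assert (Hrem : is_lim_seq
  (fun n => r ^ S n * cos (t * INR (S n)) - r ^ S (S n) * cos (t * INR n)) 0).
{ replace (Finite 0) with (Finite (0 - r ^ 2 * 0)) by (f_equal; ring).
  apply is_lim_seq_minus'.
  - apply (is_lim_seq_incr_1 (fun n => r ^ n * cos (t * INR n))).
    now apply is_lim_seq_pow_mult_bounded.
  - apply (is_lim_seq_ext (fun n => r ^ 2 * (r ^ n * cos (t * INR n)))); [intros; simpl; ring|].
    apply (is_lim_seq_scal_l _ (r ^ 2) 0). now apply is_lim_seq_pow_mult_bounded. }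
apply (is_lim_seq_ext (fun n => / D * (r * cos t - r ^ 2 -
         (r ^ S n * cos (t * INR (S n)) - r ^ S (S n) * cos (t * INR n))))).
- intros n. rewrite <- sum_pow_cos. fold D. field. lra.
- replace ((r * cos t - r ^ 2) / D) with (/ D * (r * cos t - r ^ 2 - 0)) by (field; lra).
  apply (is_lim_seq_scal_l _ (/ D) (r * cos t - r ^ 2 - 0)).
  apply is_lim_seq_minus'; [apply is_lim_seq_const|exact Hrem].
Qed.

Lemma is_lim_seq_sum_exp_cos (y v : R) :
  0 < y ->
  is_lim_seq (sum_n_m (fun m => exp (- (INR m * y)) * cos (2 * PI * v * INR m)) 1)
             ((poisson_kernel y v - 1) / 2).
Proof.
intros Hy. set (r := exp (- y)). set (t := 2 * PI * v).
assert (Hr : 0 < r < 1).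
{ split; [apply exp_pos|]. unfold r. rewrite <- exp_0. apply exp_increasing. lra. }
apply (is_lim_seq_ext (sum_n_m (fun m => r ^ m * cos (t * INR m)) 1)).
- intros n. apply sum_n_m_ext. intros m. unfold r. now rewrite exp_neg_INR_mult.
- replace ((poisson_kernel y v - 1) / 2)
    with ((r * cos t - r ^ 2) / (1 - 2 * r * cos t + r ^ 2)).
  + apply is_lim_seq_sum_pow_cos. lra.
  + pose proof (COS_bound t).
    assert (Ey : exp y = / r) by (unfold r; now rewrite exp_Ropp, Rinv_inv).
    unfold poisson_kernel, cosh, sinh. rewrite Ey. fold r t. clearbody r t. clear Ey.
    assert (0 < (1 - r) ^ 2) by (apply pow_lt; lra).
    assert (0 < 1 - 2 * r * cos t + r ^ 2) by nra.
    field. repeat split; lra.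
Qed.

Definition twisted_poisson (q : nat) (chi : nat -> C) (y : R) : C :=
  (RtoC (/ 2) * csum (fun h => chi h * RtoC (poisson_kernel y (INR h / INR q))) q)%C.

Lemma is_lim_gauss_sum_mult_exp (q : nat) (chi : nat -> C) (y : R) :
  primitive_char q chi -> even_char q chi -> (1 < q)%nat -> 0 < y ->
  is_lim_seq_C
    (fun N => gauss_sum q chi * csum (fun m => Cconj (chi m) * RtoC (exp (- (INR m * y)))) N)%C
    (twisted_poisson q chi y).
Proof.
intros Hprim He Hq Hy.
replace (twisted_poisson q chi y)
  with (csum (fun h => chi h * RtoC ((poisson_kernel y (INR h / INR q) - 1) / 2)) q)%C.
2:{ unfold twisted_poisson. pose proof (csum_primitive_char q chi Hprim Hq) as E0.
    transitivity (RtoC (/ 2) * (csum (fun h => chi h * RtoC (poisson_kernel y (INR h / INR q))) q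
                                - csum chi q))%C.
    - rewrite <- csum_minus, <- csum_mult_l. apply csum_ext. intros h _.
      unfold Rdiv. rewrite RtoC_mult, RtoC_minus. ring.
    - rewrite E0. ring. }
apply (is_lim_seq_C_ext (fun N => csum (fun h => chi h * RtoC (sum_n_m (fun m =>
  exp (- (INR m * y)) * cos (2 * PI * (INR h / INR q) * INR m))%R 1 N))%C q)).
- intros N. rewrite <- csum_mult_l.
  rewrite (csum_ext _ (fun h => csum (fun m => chi h * RtoC (exp (- (INR m * y))
             * cos (2 * PI * (INR h / INR q) * INR m))%R)%C N)).
  2:{ intros h _. now rewrite <- csum_RtoC, csum_mult_l. }
  rewrite csum_swap. apply csum_ext. intros m _.
  rewrite Cmult_assoc, (Cmult_comm (gauss_sum q chi)).
  rewrite <- (even_char_csum_cos q chi Hprim m He), <- csum_mult_r.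
  apply csum_ext. intros h _. rewrite RtoC_mult. ring.
- apply is_lim_seq_C_csum. intros h _. apply is_lim_seq_C_mult; [apply is_lim_seq_C_const|].
  now apply is_lim_seq_C_RtoC, is_lim_seq_sum_exp_cos.
Qed.

Lemma is_lim_twisted_exp (q : nat) (chi : nat -> C) (y : R) :
  primitive_char q chi -> even_char q chi -> (1 < q)%nat -> 0 < y ->
  is_lim_seq_C
    (csum (fun m => chi m * RtoC (exp (- (INR m * y))))%C)
    (gauss_sum q chi / RtoC (INR q) * twisted_poisson q (conj_char chi) y)%C.
Proof.
intros Hprim He Hq Hy.
pose proof (gauss_sum_mul_conj q chi Hprim Hq) as Eg. rewrite He, Cmult_1_l in Eg.
assert (HIq : RtoC (INR q) <> RtoC 0).
{ intros E. injection E. apply not_0_INR. lia. }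
apply (is_lim_seq_C_ext (fun N => gauss_sum q chi / RtoC (INR q) * (gauss_sum q (conj_char chi)
   * csum (fun m => Cconj (conj_char chi m) * RtoC (exp (- (INR m * y)))) N))%C).
- intros N.
  rewrite (csum_ext (fun m => Cconj (conj_char chi m) * _)%C
             (fun m => chi m * RtoC (exp (- (INR m * y))))%C).
  2:{ intros m _. unfold conj_char. now rewrite Cconj_conj. }
  set (A := csum _ _).
  replace (gauss_sum q chi / RtoC (INR q) * (gauss_sum q (conj_char chi) * A))%C
    with (gauss_sum q chi * gauss_sum q (conj_char chi) / RtoC (INR q) * A)%C by (field; exact HIq).
  rewrite Eg. field. exact HIq.
- apply is_lim_seq_C_mult; [apply is_lim_seq_C_const|].
  apply is_lim_gauss_sum_mult_exp;
    [now apply primitive_char_conj|now apply even_char_conj|exact Hq|exact Hy].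
Qed.

Lemma twisted_poisson_cauchy_series (q : nat) (chi : nat -> C) (y : R) :
  dirichlet_char q chi -> even_char q chi -> (1 < q)%nat -> 0 < y ->
  twisted_poisson q chi y = csum (fun h => chi h * RtoC (cauchy_series y (INR h / INR q)))%C q.
Proof.
intros Hc He Hq Hy. assert (HIq : 0 < INR q) by (apply lt_0_INR; lia).
set (term := fun h => (chi h * RtoC (cauchy_series y (INR h / INR q)))%C).
assert (Hrefl : csum (fun h => term (q - h)%nat) q = csum term q).
{ apply csum_reflect. unfold term. rewrite (char_modulus q chi Hc), (char_0 q chi Hc Hq). ring. }
transitivity (RtoC (/ 2) * (csum term q + csum (fun h => term (q - h)%nat) q))%C.
- rewrite <- csum_plus. unfold twisted_poisson. f_equal. apply csum_ext. intros h Hh. unfold term.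
  assert (Hhq : 0 <= INR h / INR q <= 1).
  { split; [apply Rdiv_le_0_compat; [apply pos_INR|exact HIq]|].
    apply Rle_div_l; [exact HIq|]. rewrite Rmult_1_l. apply le_INR. lia. }
  rewrite (even_char_reflect q), minus_INR by (assumption || lia).
  replace ((INR q - INR h) / INR q) with (1 - INR h / INR q) by (field; lra).
  rewrite poisson_kernel_partial_fractions, RtoC_plus by assumption. ring.
- rewrite Hrefl, RtoC_inv by lra. field.
Qed.

Lemma is_lim_twisted_cauchy (q : nat) (chi : nat -> C) (y : R) :
  dirichlet_char q chi -> even_char q chi -> (1 < q)%nat -> 0 < y ->
  is_lim_seq_C
    (fun k => csum (fun n => chi n * RtoC (cauchy_kernel y (INR n / INR q)))%C (q * k))
    (twisted_poisson q chi y).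
Proof.
intros Hc He Hq Hy. rewrite twisted_poisson_cauchy_series by assumption.
assert (HIq : 0 < INR q) by (apply lt_0_INR; lia).
apply (is_lim_seq_C_ext (fun k => csum (fun h => chi h *
  RtoC (sum_n_m (fun j => cauchy_kernel y (INR (j - 1) + INR h / INR q)) 1 k))%C q)).
- intros k. rewrite csum_blocks. apply csum_ext. intros h _.
  rewrite <- csum_RtoC, <- csum_mult_l. apply csum_ext. intros j _.
  rewrite (char_add_mul q chi Hc), plus_INR, mult_INR. do 3 f_equal. field. lra.
- apply is_lim_seq_C_csum. intros h _. apply is_lim_seq_C_mult; [apply is_lim_seq_C_const|].
  apply is_lim_seq_C_RtoC, is_lim_seq_incr_1.
  apply (is_lim_seq_ext (sum_n (fun j => cauchy_kernel y (INR j + INR h / INR q)))).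
  + intros k. rewrite <- sum_n_m_S. apply sum_n_m_ext. intros j.
    now rewrite Nat.sub_succ, Nat.sub_0_r.
  + apply (Series_correct (fun j => cauchy_kernel y (INR j + INR h / INR q))).
    apply ex_series_cauchy_kernel; [exact Hy|].
    apply Rdiv_le_0_compat; [apply pos_INR|exact HIq].
Qed.

(** * Integrals over the real line *)

Lemma Riemann_sum_linear {U V : NormedModule R_AbsRing} (l : U -> V) (f : R -> U) (ptd : SF_seq) :
  is_linear l -> l (Riemann_sum f ptd) = Riemann_sum (fun x => l (f x)) ptd.
Proof.
intros Hl.
apply (SF_cons_ind (fun s => l (Riemann_sum f s) = Riemann_sum (fun x => l (f x)) s)).
- intros x. apply (linear_zero l Hl).
- intros h s IH. now rewrite !Riemann_sum_cons, (linear_plus l Hl), (linear_scal l Hl), IH.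
Qed.

Lemma is_RInt_linear {U V : NormedModule R_AbsRing} (l : U -> V) (f : R -> U) (a b : R) (v : U) :
  is_linear l -> is_RInt f a b v -> is_RInt (fun x => l (f x)) a b (l v).
Proof.
intros Hl H. unfold is_RInt.
apply (filterlim_ext (fun ptd => l (scal (sign (b - a)) (Riemann_sum f ptd)))).
- intros ptd. now rewrite (linear_scal l Hl), Riemann_sum_linear.
- apply (filterlim_comp _ _ _ _ l _ _ _ H), (linear_cont l v Hl).
Qed.

Section ImproperIntegrals.

Context {V : NormedModule R_AbsRing} {Fa Fb : (R -> Prop) -> Prop}
  {FFa : Filter Fa} {FFb : Filter Fb}.

Lemma is_RInt_gen_linear {U : NormedModule R_AbsRing} (l : U -> V) (f : R -> U) (v : U) :
  is_linear l -> is_RInt_gen f Fa Fb v -> is_RInt_gen (fun x => l (f x)) Fa Fb (l v).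
Proof.
intros Hl H P HP. pose proof (H _ (linear_cont l v Hl P HP)) as Hf. revert Hf.
unfold filtermapi. apply filter_imp. intros [a b] [y [Hy HPy]]. exists (l y).
split; [now apply is_RInt_linear|exact HPy].
Qed.

Lemma is_RInt_gen_zero : is_RInt_gen (fun _ => zero) Fa Fb (zero : V).
Proof.
intros P HP. unfold filtermapi. apply filter_forall. intros [a b]. exists zero.
split; [|now apply locally_singleton].
pose proof (is_RInt_const a b (zero : V)) as H.
rewrite (scal_zero_r (V := V) (b - a) : scal (b - a) (zero : V) = zero) in H. exact H.
Qed.

Lemma is_RInt_gen_sum_n_m (f : nat -> R -> V) (v : nat -> V) (n m : nat) :
  (forall k, (n <= k <= m)%nat -> is_RInt_gen (f k) Fa Fb (v k)) ->
  is_RInt_gen (fun x => sum_n_m (fun k => f k x) n m) Fa Fb (sum_n_m v n m).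
Proof.
assert (Hempty : forall j, (j < n)%nat ->
  is_RInt_gen (fun x => sum_n_m (fun k => f k x) n j) Fa Fb (sum_n_m v n j)).
{ intros j Hj. rewrite sum_n_m_zero by exact Hj.
  apply (is_RInt_gen_ext (fun _ => zero)); [|apply is_RInt_gen_zero].
  apply filter_forall. intros ab x _. now rewrite sum_n_m_zero. }
induction m as [|m IH]; intros H.
- destruct n as [|n]; [|apply Hempty; lia].
  rewrite sum_n_n. apply (is_RInt_gen_ext (f 0%nat)); [|apply H; lia].
  apply filter_forall. intros ab x _. now rewrite sum_n_n.
- destruct (le_lt_dec n (S m)) as [Hn|Hn]; [|now apply Hempty].
  rewrite sum_n_Sm by exact Hn.
  apply (is_RInt_gen_ext (fun x => plus (sum_n_m (fun k => f k x) n m) (f (S m) x))).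
  + apply filter_forall. intros ab x _. now rewrite sum_n_Sm.
  + apply is_RInt_gen_plus; [apply IH; intros; apply H; lia|apply H; lia].
Qed.

Lemma is_RInt_gen_comp_lin {Ga Gb : (R -> Prop) -> Prop} (f : R -> V) (u w : R) (v : V) :
  filterlim (fun x => u * x + w) Ga Fa -> filterlim (fun x => u * x + w) Gb Fb ->
  is_RInt_gen f Fa Fb v -> is_RInt_gen (fun x => scal u (f (u * x + w))) Ga Gb v.
Proof.
intros Ha Hb H P HP. destruct (H P HP) as [Qa Qb HQa HQb HQ].
apply (Filter_prod _ _ _ (fun a => Qa (u * a + w)) (fun b => Qb (u * b + w))
         (Ha _ HQa) (Hb _ HQb)). intros a b HQa' HQb'.
destruct (HQ _ _ HQa' HQb') as [y [Hy HPy]]. exists y.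
split; [now apply is_RInt_comp_lin|exact HPy].
Qed.

End ImproperIntegrals.

Definition is_RInt_line {V : NormedModule R_AbsRing} (f : R -> V) (v : V) : Prop :=
  is_RInt_gen f (Rbar_locally m_infty) (Rbar_locally p_infty) v.

Lemma is_RInt_line_ext {V : NormedModule R_AbsRing} (f g : R -> V) (v : V) :
  (forall x, f x = g x) -> is_RInt_line f v -> is_RInt_line g v.
Proof. intros E. apply is_RInt_gen_ext, filter_forall. intros ab x _. apply E. Qed.

Lemma is_RInt_line_norm_le {V : CompleteNormedModule R_AbsRing} (f : R -> V) (g : R -> R)
  (v : V) (w : R) :
  (forall x, norm (f x) <= g x) -> is_RInt_line f v -> is_RInt_line g w -> norm v <= w.
Proof.
intros H. apply (RInt_gen_norm f g).
- apply (Filter_prod _ _ _ (fun a => a < 0) (fun b => 0 < b)); [now exists 0|now exists 0|].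
  simpl. intros; lra.
- apply filter_forall. intros ab x _. apply H.
Qed.

Lemma is_RInt_line_derive (f df : R -> R) (la lb : R) :
  (forall x, is_derive f x (df x)) -> (forall x, continuous df x) ->
  is_lim f m_infty la -> is_lim f p_infty lb -> is_RInt_line df (lb - la).
Proof.
intros Hd Hc Ha Hb.
assert (E : forall x, Derive f x = df x) by (intros x; apply is_derive_unique, Hd).
apply (is_RInt_line_ext (Derive f) _ _ E).
apply (is_RInt_gen_Derive f la lb); [| |exact Ha|exact Hb].
- apply filter_forall. intros ab x _. now exists (df x).
- apply filter_forall. intros ab x _. apply (continuous_ext df); [now intros|apply Hc].
Qed.

Lemma is_RInt_line_shift (f : R -> R) (w v : R) :
  is_RInt_line f v -> is_RInt_line (fun x => f (x + w)) v.
Proof.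
intros H. apply (is_RInt_line_ext (fun x => scal 1 (f (1 * x + w)))).
- intros x. unfold scal; simpl. unfold mult; simpl. now rewrite !Rmult_1_l.
- apply is_RInt_gen_comp_lin with (3 := H).
  + intros P [M HM]. exists (M - w). intros x Hx. apply HM. lra.
  + intros P [M HM]. exists (M - w). intros x Hx. apply HM. lra.
Qed.

Lemma is_RInt_line_even (f : R -> R) (v : R) :
  (forall x, f (- x) = f x) -> is_RInt_gen f (at_point 0) (Rbar_locally p_infty) v ->
  is_RInt_line f (2 * v).
Proof.
intros Hf H. replace (2 * v) with (plus v v) by (unfold plus; simpl; ring).
apply (is_RInt_gen_Chasles f 0 v v); [|exact H].
rewrite <- (opp_opp v). apply (is_RInt_gen_swap f).
apply (is_RInt_gen_ext (fun x => opp (scal (-1) (f (-1 * x + 0))))).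
- apply filter_forall. intros ab x _. replace (-1 * x + 0) with (- x) by ring.
  rewrite Hf. unfold opp, scal; simpl. unfold mult; simpl. ring.
- apply (is_RInt_gen_opp (fun x => scal (-1) (f (-1 * x + 0)))).
  apply is_RInt_gen_comp_lin with (3 := H).
  + intros P HP. unfold filtermap, at_point. now replace (-1 * 0 + 0) with 0 by ring.
  + intros P [M HM]. exists (- M). intros x Hx. apply HM. lra.
Qed.

Lemma ex_RInt_gen_nonneg_bounded (f : R -> R) (a M : R) :
  (forall x, continuous f x) -> (forall x, a <= x -> 0 <= f x) ->
  (forall b, a <= b -> RInt f a b <= M) ->
  ex_RInt_gen f (at_point a) (Rbar_locally p_infty).
Proof.
intros Hc Hf HM.
assert (Hex : forall b c, ex_RInt f b c).
{ intros b c. apply (ex_RInt_continuous (V := R_CompleteNormedModule)). intros; apply Hc. }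
assert (Hincr : forall b c, a <= b <= c -> RInt f a b <= RInt f a c).
{ intros b c Hbc. rewrite <- (RInt_Chasles f a b c) by apply Hex.
  pose proof (RInt_ge_0 f b c (proj2 Hbc) (Hex b c) ltac:(intros; apply Hf; lra)).
  unfold plus; simpl. lra. }
destruct (completeness (fun y => exists b, a <= b /\ y = RInt f a b)) as [l [Hub Hlub]].
- exists M. intros y [b [Hb ->]]. now apply HM.
- exists (RInt f a a), a. split; [lra|reflexivity].
- exists l. intros P [eps HP].
  destruct (classic (exists b, a <= b /\ l - eps < RInt f a b)) as [[b0 [Hb0 Hl]]|Hno].
  + apply (Filter_prod _ _ _ (fun x => x = a) (fun b => b0 < b)); [reflexivity|now exists b0|].
    intros x b -> Hb. exists (RInt f a b).
    split; [apply (RInt_correct (V := R_CompleteNormedModule)), Hex|].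
    apply HP. unfold ball; simpl. unfold AbsRing_ball, abs, minus, plus, opp; simpl.
    pose proof (Hincr b0 b ltac:(lra)).
    pose proof (Hub (RInt f a b) ltac:(exists b; split; [lra|reflexivity])).
    apply Rabs_def1; lra.
  + exfalso. pose proof (cond_pos eps).
    assert (l <= l - eps); [|lra]. apply Hlub. intros y [b [Hb ->]].
    apply Rnot_lt_le. intros Hlt. apply Hno. now exists b.
Qed.

Lemma is_linear_Cmult_RtoC (a : C) :
  is_linear (U := R_NormedModule) (V := C_R_NormedModule) (fun t => (a * RtoC t)%C).
Proof.
apply (is_linear_ext (fun t : R => scal t (a : C_R_NormedModule)));
  [|exact (is_linear_scal_l (V := C_R_NormedModule) a)].
intros t. destruct a as [x y]. unfold scal; simpl. unfold prod_scal, scal, Cmult, RtoC; simpl.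
unfold mult; simpl. f_equal; ring.
Qed.

Lemma is_linear_Cmult (a : C) :
  is_linear (U := C_R_NormedModule) (V := C_R_NormedModule) (fun z => (a * z)%C).
Proof.
split.
- intros x y. apply Cmult_plus_distr_l.
- intros k z. destruct a as [a1 a2], z as [z1 z2]. unfold scal; simpl.
  unfold prod_scal, scal, Cmult; simpl. unfold mult; simpl. f_equal; ring.
- exists (Cmod a + 1). pose proof (Cmod_ge_0 a). split; [lra|]. intros z.
  rewrite <- !Cmod_norm, Cmod_mult. pose proof (Cmod_ge_0 z). nra.
Qed.

Definition logistic_weight (u : R) : R := exp (u / 2) / (1 + exp (u / 2)) ^ 2.

Lemma continuous_logistic_weight (u : R) : continuous logistic_weight u.
Proof.
apply (ex_derive_continuous (V := R_NormedModule)). unfold logistic_weight. auto_derive.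
pose proof (exp_pos (u * / 2)). nra.
Qed.

Lemma is_RInt_line_logistic_weight : is_RInt_line logistic_weight 2.
Proof.
replace 2 with (2 / (1 + 0) - 2 * 0 / (1 + 0)) by field.
apply (is_RInt_line_derive (fun u => 2 * exp (/ 2 * u) / (1 + exp (/ 2 * u)))).
- intros u. unfold logistic_weight. replace (u / 2) with (/ 2 * u) by field.
  pose proof (exp_pos (/ 2 * u)). auto_derive; [lra|]. field. lra.
- exact continuous_logistic_weight.
- apply (is_lim_comp_continuous (fun u => exp (/ 2 * u)) (fun t => 2 * t / (1 + t)) m_infty 0).
  + apply is_lim_exp_scal_m. lra.
  + apply (ex_derive_continuous (V := R_NormedModule)). auto_derive. lra.
- apply (is_lim_ext (fun u => 2 / (1 + exp (- / 2 * u)))).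
  + intros u. replace (- / 2 * u) with (- (/ 2 * u)) by ring. rewrite exp_Ropp.
    pose proof (exp_pos (/ 2 * u)). field. lra.
  + apply (is_lim_comp_continuous (fun u => exp (- / 2 * u)) (fun t => 2 / (1 + t)) p_infty 0).
    * apply is_lim_exp_scal_p. lra.
    * apply (ex_derive_continuous (V := R_NormedModule)). auto_derive. lra.
Qed.

(** * The Bessel and logarithmic integrals *)

Lemma continuous_exp_cosh (z t : R) : continuous (fun t => exp (- z * cosh t)) t.
Proof. apply (ex_derive_continuous (V := R_NormedModule)). unfold cosh. now auto_derive. Qed.

Lemma RInt_exp_cosh_le (z b : R) :
  0 < z -> 0 <= b -> RInt (fun t => exp (- z * cosh t)) 0 b <= / z.
Proof.
intros Hz Hb. set (h := fun t => - / z * exp (- z * t)).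
assert (I : is_RInt (fun t => exp (- z * t)) 0 b (h b - h 0)).
{ apply (is_RInt_derive (V := R_CompleteNormedModule) h (fun t => exp (- z * t))).
  - intros t _. unfold h. auto_derive; [trivial|]. field. lra.
  - intros t _. apply (ex_derive_continuous (V := R_NormedModule)). now auto_derive. }
apply Rle_trans with (RInt (fun t => exp (- z * t)) 0 b).
- apply RInt_le; [exact Hb| |now exists (h b - h 0)|].
  + apply (ex_RInt_continuous (V := R_CompleteNormedModule)). intros; apply continuous_exp_cosh.
  + intros t Ht. left. apply exp_increasing.
    assert (t < cosh t); [|nra].
    pose proof (sinh_ge_id t ltac:(lra)). pose proof (exp_pos (- t)).
    unfold sinh, cosh in *. lra.
- rewrite (is_RInt_unique _ _ _ _ I). unfold h. rewrite Rmult_0_r, exp_0.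
  pose proof (Rinv_0_lt_compat z Hz). pose proof (exp_pos (- z * b)). nra.
Qed.

Lemma is_RInt_line_exp_cosh (z : R) :
  0 < z -> is_RInt_line (fun t => exp (- z * cosh t)) (2 * K0 z).
Proof.
intros Hz. apply is_RInt_line_even.
- intros t. do 2 f_equal. unfold cosh. rewrite Ropp_involutive. field.
- apply (RInt_gen_correct (V := R_CompleteNormedModule)).
  apply (ex_RInt_gen_nonneg_bounded _ 0 (/ z)).
  + intros t. apply continuous_exp_cosh.
  + intros t _. left. apply exp_pos.
  + intros b Hb. now apply RInt_exp_cosh_le.
Qed.

Lemma is_RInt_line_bessel (c m n : R) :
  0 < c -> 0 < m -> 0 < n ->
  is_RInt_line (fun u => exp (- (m * (c * exp u))) * exp (- (n * (c * exp (- u)))))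
               (2 * K0 (2 * c * sqrt (m * n))).
Proof.
intros Hc Hm Hn. set (s := ln (m / n) / 2).
assert (Hmn : 0 < m * n) by nra. pose proof (sqrt_lt_R0 _ Hmn) as Hsqrt.
assert (Hln : ln (sqrt (m * n)) = (ln m + ln n) / 2).
{ rewrite <- ln_mult by assumption. rewrite <- (sqrt_sqrt (m * n)) at 2 by lra.
  rewrite ln_mult by exact Hsqrt. field. }
assert (Em : sqrt (m * n) * exp s = m).
{ transitivity (exp (ln m)); [|now apply exp_ln].
  rewrite <- (exp_ln _ Hsqrt), <- exp_plus. f_equal.
  rewrite Hln. unfold s. rewrite ln_div by assumption. field. }
assert (En : sqrt (m * n) * exp (- s) = n).
{ transitivity (exp (ln n)); [|now apply exp_ln].
  rewrite <- (exp_ln _ Hsqrt), <- exp_plus. f_equal.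
  rewrite Hln. unfold s. rewrite ln_div by assumption. field. }
apply (is_RInt_line_ext (fun u => exp (- (2 * c * sqrt (m * n)) * cosh (u + s)))).
- intros u. rewrite <- exp_plus. f_equal. unfold cosh.
  replace (- (u + s)) with (- u + - s) by ring. rewrite !exp_plus.
  rewrite <- Em at 2. rewrite <- En at 3. field.
- apply (is_RInt_line_shift (fun t => exp (- (2 * c * sqrt (m * n)) * cosh t))).
  apply is_RInt_line_exp_cosh. nra.
Qed.

Lemma is_RInt_line_log (k l : R) :
  0 < k -> 0 < l -> k * l <> 1 ->
  is_RInt_line (fun u => exp (2 * u) / ((exp (2 * u) + k ^ 2) * (1 + l ^ 2 * exp (2 * u))))
               (ln (k * l) / ((k * l) ^ 2 - 1)).
Proof.
intros Hk Hl Hne. pose proof (pow_lt k 2 Hk) as Hk2. pose proof (pow_lt l 2 Hl) as Hl2.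
assert (Hd : (k * l) ^ 2 - 1 <> 0).
{ intros E. assert (E' : (k * l - 1) * (k * l + 1) = 0) by lra.
  apply Rmult_integral in E'. nra. }
set (d := / (2 * ((k * l) ^ 2 - 1))).
assert (Hln2 : forall t, 0 < t -> ln (t ^ 2) = 2 * ln t).
{ intros t Ht. replace (t ^ 2) with (t * t) by ring. rewrite ln_mult by exact Ht. ring. }
replace (ln (k * l) / ((k * l) ^ 2 - 1))
  with (d * (ln (0 + l ^ 2) - ln (1 + k ^ 2 * 0)) - d * (ln (1 + l ^ 2 * 0) - ln (0 + k ^ 2))).
2:{ unfold d. rewrite !Rmult_0_r, !Rplus_0_l, !Rplus_0_r, ln_1, !Hln2, ln_mult by assumption.
    field. exact Hd. }
apply (is_RInt_line_derive (fun u =>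
  d * (ln (1 + l ^ 2 * exp (2 * u)) - ln (exp (2 * u) + k ^ 2)))).
- intros u. pose proof (exp_pos (2 * u)). auto_derive; [repeat split; nra|].
  unfold d. field. repeat split; nra.
- intros u. apply (ex_derive_continuous (V := R_NormedModule)). pose proof (exp_pos (2 * u)).
  auto_derive. apply Rgt_not_eq, Rmult_lt_0_compat; nra.
- apply (is_lim_comp_continuous (fun u => exp (2 * u))
           (fun t => d * (ln (1 + l ^ 2 * t) - ln (t + k ^ 2))) m_infty 0).
  + apply is_lim_exp_scal_m. lra.
  + apply (ex_derive_continuous (V := R_NormedModule)). auto_derive. lra.
- apply (is_lim_ext (fun u =>
    d * (ln (exp (- (2) * u) + l ^ 2) - ln (1 + k ^ 2 * exp (- (2) * u))))).
  + intros u. pose proof (exp_pos (2 * u)). replace (- (2) * u) with (- (2 * u)) by ring.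
    rewrite exp_Ropp. set (t := exp (2 * u)) in *.
    replace (/ t + l ^ 2) with ((1 + l ^ 2 * t) / t) by (field; lra).
    replace (1 + k ^ 2 * / t) with ((t + k ^ 2) / t) by (field; lra).
    rewrite !ln_div by nra. ring.
  + apply (is_lim_comp_continuous (fun u => exp (- (2) * u))
             (fun t => d * (ln (t + l ^ 2) - ln (1 + k ^ 2 * t))) p_infty 0).
    * apply is_lim_exp_scal_p. lra.
    * apply (ex_derive_continuous (V := R_NormedModule)). auto_derive. lra.
Qed.

Definition log_kernel (beta t : R) : R := ln (t / beta) / (t ^ 2 - beta ^ 2).

Lemma is_RInt_line_cauchy_kernel (c v w beta t : R) :
  0 < c -> 0 < v -> 0 < w -> 0 < beta -> 4 * PI ^ 2 * (v * w) * beta = c ^ 2 * t -> t <> beta ->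
  is_RInt_line (fun u => cauchy_kernel (c * exp u) v * cauchy_kernel (c * exp (- u)) w)
    (4 * beta ^ 2 / c ^ 2 * log_kernel beta t).
Proof.
intros Hc Hv Hw Hbeta Et Hne. pose proof PI_RGT_0.
set (k := 2 * PI * v / c). set (l := 2 * PI * w / c).
assert (Hk : 0 < k) by (apply Rdiv_lt_0_compat; nra).
assert (Hl : 0 < l) by (apply Rdiv_lt_0_compat; nra).
assert (Hkl : 0 < k * l) by now apply Rmult_lt_0_compat.
assert (Et' : t = k * l * beta).
{ apply (Rmult_eq_reg_l (c ^ 2)); [|apply pow_nonzero; lra].
  rewrite <- Et. unfold k, l. field. lra. }
assert (Hkl1 : k * l <> 1) by (intros E; apply Hne; rewrite Et', E; ring).
replace (4 * beta ^ 2 / c ^ 2 * log_kernel beta t)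
  with (4 / c ^ 2 * (ln (k * l) / ((k * l) ^ 2 - 1))).
2:{ unfold log_kernel. rewrite Et'.
    replace (k * l * beta / beta) with (k * l) by (field; lra).
    assert (Hd : (k * l) ^ 2 - 1 <> 0) by (intros E; apply Hkl1; nra).
    field. repeat split; try lra.
    replace ((k * l * beta) ^ 2 - beta ^ 2) with (beta ^ 2 * ((k * l) ^ 2 - 1)) by ring.
    apply Rmult_integral_contrapositive_currified; [apply pow_nonzero; lra|exact Hd]. }
apply (is_RInt_line_ext (fun u => scal (4 / c ^ 2)
  (exp (2 * u) / ((exp (2 * u) + k ^ 2) * (1 + l ^ 2 * exp (2 * u)))))).
- intros u. unfold scal; simpl. unfold mult; simpl. unfold cauchy_kernel.
  replace (2 * PI * v) with (k * c) by (unfold k; field; lra).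
  replace (2 * PI * w) with (l * c) by (unfold l; field; lra).
  replace (2 * u) with (u + u) by ring. rewrite exp_plus, exp_Ropp.
  pose proof (exp_pos u). pose proof (pow_lt c 2 Hc).
  pose proof (pow_lt (k * c) 2 ltac:(nra)). pose proof (pow2_ge_0 (c * exp u)).
  pose proof (pow2_ge_0 (l * c * exp u)). field. repeat split; try lra; nra.
- apply (is_RInt_gen_scal (V := R_NormedModule)). now apply is_RInt_line_log.
Qed.

(** * Uniform decay of the kernels *)

Definition kernel_decay (a : R) (phi : nat -> R -> R) : Prop :=
  exists A, forall m y s, (1 <= m)%nat -> 0 < y -> a <= s <= a + 1 / 2 ->
    0 <= phi m y <= A * Rpower (INR m) (- (3 / 2)) * Rpower y s.

Lemma kernel_decay_nonneg (a : R) (phi : nat -> R -> R) (m : nat) (y : R) :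
  kernel_decay a phi -> (1 <= m)%nat -> 0 < y -> 0 <= phi m y.
Proof. intros [A H] Hm Hy. apply (H m y a Hm Hy). lra. Qed.

Lemma kernel_decay_exp : kernel_decay (- (2)) (fun m y => exp (- (INR m * y))).
Proof.
exists (Rpower 2 2). intros m y s Hm Hy Hs. split; [left; apply exp_pos|].
assert (Hm1 : 1 <= INR m) by (apply (le_INR 1), Hm).
eapply Rle_trans; [apply (exp_neg_le_Rpower (- s)); nra|].
rewrite <- Rpower_mult_distr, Ropp_involutive, <- Rmult_assoc by lra.
apply Rmult_le_compat_r; [left; apply Rpower_pos|].
apply Rmult_le_compat; try (left; apply Rpower_pos).
- apply Rle_trans with (Rpower 2 (- s)); [apply Rle_Rpower_l; lra|apply Rle_Rpower; lra].
- apply Rle_Rpower; lra.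
Qed.

Lemma kernel_decay_cauchy (q : nat) :
  (1 <= q)%nat -> kernel_decay (1 / 2) (fun n y => cauchy_kernel y (INR n / INR q)).
Proof.
intros Hq. assert (Hq1 : 1 <= INR q) by (apply (le_INR 1), Hq).
exists (2 * Rpower (INR q) 2). intros n y s Hn Hy Hs. split; [left; now apply cauchy_kernel_pos|].
assert (Hn1 : 1 <= INR n) by (apply (le_INR 1), Hn).
assert (Hnq : 0 < INR n / INR q) by (apply Rdiv_lt_0_compat; lra).
eapply Rle_trans; [apply (cauchy_kernel_le (1 - s)); lra|].
replace (1 - (1 - s)) with s by ring. replace (- (2 - (1 - s))) with (- (1 + s)) by ring.
assert (Hpow : Rpower (INR n / INR q) (- (1 + s)) <= Rpower (INR q) 2 * Rpower (INR n) (- (3 / 2))).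
{ unfold Rdiv at 1.
  rewrite <- Rpower_mult_distr, Rmult_comm by (try apply Rinv_0_lt_compat; lra).
  apply Rmult_le_compat; try (left; apply Rpower_pos).
  - replace (Rpower (/ INR q) (- (1 + s))) with (Rpower (INR q) (1 + s)).
    + apply Rle_Rpower; lra.
    + unfold Rpower. f_equal. rewrite ln_Rinv by lra. ring.
  - apply Rle_Rpower; lra. }
pose proof (Rpower_pos y s). nra.
Qed.

Lemma le_logistic_weight (T D u : R) :
  0 <= D -> T <= D * exp (u / 2) -> T <= D * exp (- (u / 2)) -> T <= 4 * D * logistic_weight u.
Proof.
intros HD Hp Hm. rewrite exp_Ropp in Hm. unfold logistic_weight.
pose proof (exp_pos (u / 2)) as HE. set (E := exp (u / 2)) in *.
replace (4 * D * (E / (1 + E) ^ 2)) with (4 * D * E / (1 + E) ^ 2) by (field; lra).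
apply Rle_div_r; [nra|].
destruct (Rle_dec E 1) as [H|H].
- apply Rle_trans with (D * E * (1 + E) ^ 2); [apply Rmult_le_compat_r; nra|].
  assert ((1 + E) ^ 2 <= 4) by nra. assert (0 <= D * E) by nra. nra.
- apply Rle_trans with (D * / E * (1 + E) ^ 2); [apply Rmult_le_compat_r; nra|].
  assert (E4 : (1 + E) ^ 2 <= 4 * E ^ 2) by nra.
  apply Rle_trans with (D * / E * (4 * E ^ 2)); [|right; field; lra].
  apply Rmult_le_compat_l; [|exact E4].
  apply Rmult_le_pos; [exact HD|left; now apply Rinv_0_lt_compat].
Qed.

(* Pairing the exponents a and a + 1/2 in either order yields both factors e^(u/2) and e^(-u/2). *)
Lemma kernel_decay_mult (a c : R) (phi psi : nat -> R -> R) :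
  kernel_decay a phi -> kernel_decay a psi -> 0 < c ->
  exists B, forall m n u, (1 <= m)%nat -> (1 <= n)%nat ->
    phi m (c * exp u) * psi n (c * exp (- u))
    <= B * Rpower (INR (m * n)) (- (3 / 2)) * logistic_weight u.
Proof.
intros [A1 H1] [A2 H2] Hc. exists (4 * (A1 * A2 * Rpower c (2 * a + 1 / 2))). intros m n u Hm Hn.
assert (Hy : forall v, 0 < c * exp v) by (intros v; apply Rmult_lt_0_compat, exp_pos; exact Hc).
assert (Hm0 : 0 < INR m) by (apply lt_0_INR; lia).
assert (Hn0 : 0 < INR n) by (apply lt_0_INR; lia).
set (D := A1 * A2 * Rpower c (2 * a + 1 / 2) * Rpower (INR (m * n)) (- (3 / 2))).
assert (Hprod : forall s t, a <= s <= a + 1 / 2 -> s + t = 2 * a + 1 / 2 ->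
  0 <= phi m (c * exp u) * psi n (c * exp (- u)) <= D * exp ((s - t) * u)).
{ intros s t Hs Hst.
  destruct (H1 m _ s Hm (Hy u) Hs) as [Hphi0 Hphi].
  destruct (H2 n _ t Hn (Hy (- u)) ltac:(lra)) as [Hpsi0 Hpsi].
  split; [now apply Rmult_le_pos|].
  eapply Rle_trans; [apply Rmult_le_compat; [exact Hphi0|exact Hpsi0|exact Hphi|exact Hpsi]|].
  right. unfold D. rewrite mult_INR, <- (Rpower_mult_distr (INR m)) by assumption.
  rewrite !Rpower_scal_exp, <- Hst, Rpower_plus by exact Hc.
  replace ((s - t) * u) with (s * u + t * - u) by ring. rewrite exp_plus. ring. }
replace (4 * (A1 * A2 * Rpower c (2 * a + 1 / 2)) * Rpower (INR (m * n)) (- (3 / 2)))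
  with (4 * D) by (unfold D; ring).
pose proof (Hprod (a + 1 / 2) a ltac:(lra) ltac:(lra)) as Hplus.
pose proof (Hprod a (a + 1 / 2) ltac:(lra) ltac:(lra)) as Hminus.
replace ((a + 1 / 2 - a) * u) with (u / 2) in Hplus by field.
replace ((a - (a + 1 / 2)) * u) with (- (u / 2)) in Hminus by field.
apply le_logistic_weight; [|apply Hplus|apply Hminus].
pose proof (exp_pos (u / 2)). nra.
Qed.

(** * The hyperbola method *)

Definition hyperbola_sum (N : nat) (F : nat -> nat -> C) : C :=
  csum (fun i => csum (fun j => if (i * j <=? N)%nat then F i j else RtoC 0) N) N.

Lemma hyperbola_sum_rect (N m n : nat) (F : nat -> nat -> C) :
  (N <= m)%nat -> (N <= n)%nat ->
  hyperbola_sum N F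
  = csum (fun i => csum (fun j => if (i * j <=? N)%nat then F i j else RtoC 0) n) m.
Proof.
intros Hm Hn. unfold hyperbola_sum. symmetry. rewrite (csum_extend _ N m Hm).
- apply csum_ext. intros i Hi. apply csum_extend; [exact Hn|].
  intros j Hj. destruct (Nat.leb_spec (i * j) N); [nia|reflexivity].
- intros i Hi. apply csum_zero. intros j Hj.
  destruct (Nat.leb_spec (i * j) N); [nia|reflexivity].
Qed.

Lemma csum_multiples (f : nat -> C) (d N : nat) :
  (1 <= d)%nat ->
  csum (fun n => if (n mod d =? 0)%nat then f n else RtoC 0) N
  = csum (fun j => if (d * j <=? N)%nat then f (d * j)%nat else RtoC 0) N.
Proof.
intros Hd.
rewrite (csum_ext _ (fun n =>
  csum (fun j => if (d * j =? n)%nat then f (d * j)%nat else RtoC 0) N)).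
2:{ intros n Hn. destruct (Nat.eqb_spec (n mod d) 0) as [E|E].
    - apply Nat.Div0.mod_divides in E. destruct E as [j ->].
      rewrite (csum_single _ N j); [now rewrite Nat.eqb_refl|nia|].
      intros i _ Hi. destruct (Nat.eqb_spec (d * i) (d * j)); [nia|reflexivity].
    - symmetry. apply csum_zero. intros j _.
      destruct (Nat.eqb_spec (d * j) n) as [Ej|Ej]; [exfalso|reflexivity].
      apply E, Nat.Div0.mod_divides. now exists j. }
rewrite csum_swap. apply csum_ext. intros j Hj. destruct (Nat.leb_spec (d * j) N) as [L|L].
- rewrite (csum_single _ N (d * j)); [now rewrite Nat.eqb_refl|nia|].
  intros n _ Hn. destruct (Nat.eqb_spec (d * j) n); [now subst n|reflexivity].
- apply csum_zero. intros n Hn. destruct (Nat.eqb_spec (d * j) n); [lia|reflexivity].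
Qed.

Lemma csum_dchi (c1 c2 h : nat -> C) (N : nat) :
  csum (fun n => dchi c1 c2 n * h n)%C N
  = hyperbola_sum N (fun i j => c1 i * c2 j * h (i * j)%nat)%C.
Proof.
rewrite (csum_ext _ (fun n => csum (fun d =>
   if (n mod d =? 0)%nat then c1 d * c2 (n / d)%nat * h n else RtoC 0) N)%C).
2:{ intros n Hn. change (dchi c1 c2 n) with (csum (fun d =>
      if (n mod d =? 0)%nat then c1 d * c2 (n / d)%nat else RtoC 0)%C n).
    rewrite <- csum_mult_r, <- (csum_extend _ n N).
    - apply csum_ext. intros d _. destruct (n mod d =? 0)%nat; ring.
    - lia.
    - intros d Hd. rewrite Nat.mod_small by lia.
      destruct (Nat.eqb_spec n 0); [lia|ring]. }
rewrite csum_swap. apply csum_ext. intros d Hd.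
rewrite (csum_multiples (fun n => c1 d * c2 (n / d)%nat * h n)%C) by lia.
apply csum_ext. intros j _. now rewrite Nat.mul_comm, Nat.div_mul by lia.
Qed.

(* Off the hyperbola i j <= N the factor (i j)^(-delta) is at most (N + 1)^(-delta),
   and the remaining double series factorizes. *)
Lemma hyperbola_remainder_le (f g : nat -> C) (s delta B : R) (N m n : nat) :
  1 < s -> 0 <= delta -> (N <= m)%nat -> (N <= n)%nat ->
  (forall i j, (1 <= i)%nat -> (1 <= j)%nat ->
     Cmod (f i * g j) <= B * Rpower (INR (i * j)) (- (s + delta))) ->
  Cmod (csum f m * csum g n - hyperbola_sum N (fun i j => f i * g j)%C)
  <= B * Rpower (INR (S N)) (- delta) * (s / (s - 1)) ^ 2.
Proof.
intros Hs Hdelta Hm Hn H. set (w := fun i => Rpower (INR i) (- s)).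
set (e := B * Rpower (INR (S N)) (- delta)). set (Z := s / (s - 1)).
assert (HB : 0 <= B).
{ pose proof (H 1%nat 1%nat (le_n _) (le_n _)) as H11.
  pose proof (Cmod_ge_0 (f 1%nat * g 1%nat)). simpl INR in H11. rewrite Rpower_1_l in H11. lra. }
assert (He : 0 <= e) by (apply Rmult_le_pos; [exact HB|left; apply Rpower_pos]).
assert (HZ : 0 <= Z) by (apply Rdiv_le_0_compat; lra).
assert (Hw : forall i, 0 <= w i) by (intros; left; apply Rpower_pos).
rewrite (hyperbola_sum_rect N m n) by assumption.
rewrite <- csum_mult_r, <- csum_minus.
apply Rle_trans with (e * Z * sum_n_m w 1 m).
- apply Cmod_csum_le. intros i Hi. rewrite <- csum_mult_l, <- csum_minus.
  apply Rle_trans with (e * w i * sum_n_m w 1 n).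
  + apply Cmod_csum_le. intros j Hj. destruct (Nat.leb_spec (i * j) N) as [L|L].
    * replace (f i * g j - f i * g j)%C with (RtoC 0) by ring. rewrite Cmod_0.
      apply Rmult_le_pos; [apply Rmult_le_pos|]; auto.
    * replace (f i * g j - 0)%C with (f i * g j)%C by ring.
      eapply Rle_trans; [apply H; lia|]. unfold e. rewrite !Rmult_assoc.
      apply Rmult_le_compat_l; [exact HB|].
      assert (Hi0 : 0 < INR i) by (apply lt_0_INR; lia).
      assert (Hj0 : 0 < INR j) by (apply lt_0_INR; lia).
      assert (HN0 : 0 < INR (S N)) by (apply lt_0_INR; lia).
      unfold w. rewrite (Rpower_mult_distr (INR i)), <- mult_INR, Ropp_plus_distr by assumption.
      rewrite Rpower_plus, Rmult_comm.
      apply Rmult_le_compat_r; [left; apply Rpower_pos|].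
      apply Rpower_Ropp_le; [exact Hdelta|]. split; [exact HN0|apply le_INR; lia].
  + replace (e * Z * w i) with (e * w i * Z) by ring.
    apply Rmult_le_compat_l; [now apply Rmult_le_pos|now apply sum_Rpower_le].
- replace (e * Z ^ 2) with (e * Z * Z) by ring.
  apply Rmult_le_compat_l; [now apply Rmult_le_pos|now apply sum_Rpower_le].
Qed.

Lemma hyperbola_approx (f g : nat -> C) (F G : C) (k l : nat -> nat) (s delta B : R) (N : nat) :
  1 < s -> 0 <= delta -> (forall n, (n <= k n)%nat) -> (forall n, (n <= l n)%nat) ->
  is_lim_seq_C (fun n => csum f (k n)) F -> is_lim_seq_C (fun n => csum g (l n)) G ->
  (forall i j, (1 <= i)%nat -> (1 <= j)%nat ->
     Cmod (f i * g j) <= B * Rpower (INR (i * j)) (- (s + delta))) ->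
  Cmod (F * G - hyperbola_sum N (fun i j => f i * g j)%C)
  <= B * Rpower (INR (S N)) (- delta) * (s / (s - 1)) ^ 2.
Proof.
intros Hs Hdelta Hk Hl HF HG H.
apply (Cmod_lim_le _ _ _ _ (is_lim_seq_C_mult _ _ _ _ HF HG)).
exists N. intros n Hn. specialize (Hk n). specialize (Hl n).
now apply hyperbola_remainder_le; try lia.
Qed.

(** * Divisor sums as integrals *)

(* Stands in for "V N tends to the integral of P" without requiring P itself to be integrable. *)
Definition integral_approx (P : R -> C) (V : nat -> C) : Prop :=
  exists (F : nat -> R -> C) (e : nat -> R), is_lim_seq e 0 /\
    forall N, is_RInt_line (V := C_R_NormedModule) (F N) (V N) /\
      forall u, Cmod (P u - F N u) <= e N * logistic_weight u.

Lemma is_RInt_line_dist (P F1 F2 : R -> C) (V1 V2 : C) (e1 e2 : R) :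
  is_RInt_line (V := C_R_NormedModule) F1 V1 -> is_RInt_line (V := C_R_NormedModule) F2 V2 ->
  (forall u, Cmod (P u - F1 u) <= e1 * logistic_weight u) ->
  (forall u, Cmod (P u - F2 u) <= e2 * logistic_weight u) ->
  Cmod (V1 - V2) <= (e1 + e2) * 2.
Proof.
intros I1 I2 B1 B2. rewrite Cmod_norm.
apply (is_RInt_line_norm_le (V := C_R_CompleteNormedModule) (fun u => minus (F1 u) (F2 u))
  (fun u => scal (e1 + e2) (logistic_weight u)) (minus V1 V2) (scal (e1 + e2) 2)).
- intros u. apply Rle_trans with (Cmod (F1 u - F2 u)); [right; symmetry; apply Cmod_norm|].
  unfold scal; simpl. unfold mult; simpl. rewrite Rmult_plus_distr_r.
  replace (F1 u - F2 u)%C with (- (P u - F1 u) + (P u - F2 u))%C by ring.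
  eapply Rle_trans; [apply Cmod_triangle|]. rewrite Cmod_opp.
  now apply Rplus_le_compat.
- now apply (is_RInt_gen_minus (V := C_R_NormedModule)).
- apply (is_RInt_gen_scal (V := R_NormedModule)), is_RInt_line_logistic_weight.
Qed.

Lemma integral_approx_lim (P : R -> C) (V : nat -> C) :
  integral_approx P V -> exists l, is_lim_seq_C V l.
Proof.
intros [F [e [He HV]]]. apply (is_lim_seq_C_cauchy V (fun n => 2 * e n)).
- intros n m. replace (2 * e n + 2 * e m) with ((e n + e m) * 2) by ring.
  now apply (is_RInt_line_dist P (F n) (F m)); apply HV.
- now apply is_lim_seq_scal_0.
Qed.

Lemma integral_approx_unique (P : R -> C) (V V' : nat -> C) (l : C) :
  integral_approx P V -> integral_approx P V' -> is_lim_seq_C V l -> is_lim_seq_C V' l.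
Proof.
intros [F [e [He HV]]] [F' [e' [He' HV']]] Hl.
apply (is_lim_seq_C_ext (fun n => (V' n - V n) + V n)%C); [intros n; ring|].
rewrite <- (Cplus_0_l l). apply is_lim_seq_C_plus; [|exact Hl].
apply (is_lim_seq_C_squeeze _ _ (fun n => 2 * (e' n + e n))).
- intros n. replace (V' n - V n - 0)%C with (V' n - V n)%C by ring.
  rewrite Rmult_comm.
  apply (is_RInt_line_dist P (F' n) (F n)); [apply HV'|apply HV|apply HV'|apply HV].
- apply is_lim_seq_scal_0. rewrite <- (Rplus_0_l 0). now apply is_lim_seq_plus'.
Qed.

Lemma integral_approx_ext (P Q : R -> C) (V : nat -> C) :
  (forall u, P u = Q u) -> integral_approx P V -> integral_approx Q V.
Proof.
intros E [F [e [He HV]]]. exists F, e. split; [exact He|]. intros N.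
destruct (HV N) as [HI HB]. split; [exact HI|]. intros u. rewrite <- E. apply HB.
Qed.

Lemma integral_approx_Cmult (z : C) (P : R -> C) (V : nat -> C) :
  integral_approx P V -> integral_approx (fun u => z * P u)%C (fun N => z * V N)%C.
Proof.
intros [F [e [He HV]]]. exists (fun N u => z * F N u)%C, (fun N => Cmod z * e N). split.
- now apply is_lim_seq_scal_0.
- intros N. destruct (HV N) as [HI HB]. split.
  + now apply (is_RInt_gen_linear (U := C_R_NormedModule) (fun w => z * w)%C _ _
                 (is_linear_Cmult z)).
  + intros u. replace (z * P u - z * F N u)%C with (z * (P u - F N u))%C by ring.
    rewrite Cmod_mult, Rmult_assoc. apply Rmult_le_compat_l; [apply Cmod_ge_0|apply HB].
Qed.

Lemma is_RInt_line_hyperbola_sum (c1 c2 : nat -> C) (phi psi : nat -> R -> R) (h : nat -> R)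
  (N : nat) :
  (forall i j, (1 <= i)%nat -> (1 <= j)%nat ->
     is_RInt_line (fun u => phi i u * psi j u) (h (i * j)%nat)) ->
  is_RInt_line (V := C_R_NormedModule)
    (fun u => hyperbola_sum N (fun i j => (c1 i * RtoC (phi i u)) * (c2 j * RtoC (psi j u)))%C)
    (csum (fun n => dchi c1 c2 n * RtoC (h n))%C N).
Proof.
intros H. rewrite (csum_dchi c1 c2 (fun n => RtoC (h n))).
apply (is_RInt_gen_sum_n_m (V := C_R_NormedModule)). intros i Hi.
apply (is_RInt_gen_sum_n_m (V := C_R_NormedModule)). intros j Hj.
destruct (i * j <=? N)%nat; [|apply (is_RInt_gen_zero (V := C_R_NormedModule))].
assert (E : forall u, (c1 i * c2 j * RtoC (phi i u * psi j u)
                       = c1 i * RtoC (phi i u) * (c2 j * RtoC (psi j u)))%C).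
{ intros u. rewrite RtoC_mult. ring. }
apply (is_RInt_line_ext (V := C_R_NormedModule) _ _ _ E).
apply (is_RInt_gen_linear (U := R_NormedModule) (fun t => c1 i * c2 j * RtoC t)%C _ _
         (is_linear_Cmult_RtoC _)).
apply H; lia.
Qed.

Lemma integral_approx_dchi (c1 c2 : nat -> C) (phi psi : nat -> R -> R) (F G : R -> C)
  (k l : nat -> nat) (h : nat -> R) (a c : R) :
  0 < c -> kernel_decay a phi -> kernel_decay a psi ->
  (forall n, Cmod (c1 n) <= 1) -> (forall n, Cmod (c2 n) <= 1) ->
  (forall n, (n <= k n)%nat) -> (forall n, (n <= l n)%nat) ->
  (forall y, 0 < y ->
     is_lim_seq_C (fun n => csum (fun i => c1 i * RtoC (phi i y))%C (k n)) (F y)) ->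
  (forall y, 0 < y ->
     is_lim_seq_C (fun n => csum (fun j => c2 j * RtoC (psi j y))%C (l n)) (G y)) ->
  (forall i j, (1 <= i)%nat -> (1 <= j)%nat ->
     is_RInt_line (fun u => phi i (c * exp u) * psi j (c * exp (- u))) (h (i * j)%nat)) ->
  integral_approx (fun u => F (c * exp u)%R * G (c * exp (- u))%R)%C
    (csum (fun n => dchi c1 c2 n * RtoC (h n))%C).
Proof.
intros Hc Hphi Hpsi Hc1 Hc2 Hk Hl HF HG Hh.
destruct (kernel_decay_mult a c phi psi Hphi Hpsi Hc) as [B HB].
assert (Hy : forall v, 0 < c * exp v) by (intros v; apply Rmult_lt_0_compat, exp_pos; exact Hc).
exists (fun N u => hyperbola_sum N (fun i j =>
  (c1 i * RtoC (phi i (c * exp u)%R)) * (c2 j * RtoC (psi j (c * exp (- u))%R)))%C),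
  (fun N => B * 25 * Rpower (INR (S N)) (- (1 / 4))).
split; [|intros N; split].
- apply is_lim_seq_scal_0, is_lim_seq_Rpower_Ropp. lra.
- now apply (is_RInt_line_hyperbola_sum c1 c2 (fun i u => phi i (c * exp u))
               (fun j u => psi j (c * exp (- u)))).
- intros u. eapply Rle_trans.
  + apply (hyperbola_approx _ _ _ _ k l (5 / 4) (1 / 4) (B * logistic_weight u));
      [lra|lra|exact Hk|exact Hl|now apply HF|now apply HG|].
    intros i j Hi Hj.
    replace (5 / 4 + 1 / 4) with (3 / 2) by field.
    pose proof (kernel_decay_nonneg a phi i _ Hphi Hi (Hy u)).
    pose proof (kernel_decay_nonneg a psi j _ Hpsi Hj (Hy (- u))).
    apply Rle_trans with (phi i (c * exp u) * psi j (c * exp (- u))).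
    * rewrite !Cmod_mult, !Cmod_R, !Rabs_pos_eq by assumption.
      specialize (Hc1 i). specialize (Hc2 j).
      pose proof (Cmod_ge_0 (c1 i)). pose proof (Cmod_ge_0 (c2 j)).
      apply Rmult_le_compat; nra.
    * eapply Rle_trans; [now apply HB|]. right. ring.
  + right. field.
Qed.

Section VoronoiSummation.

Variables (p q : nat) (chi1 chi2 : nat -> C) (c beta : R).
Hypotheses (chi1_primitive : primitive_char p chi1) (chi1_even : even_char p chi1)
  (p_gt_1 : (1 < p)%nat)
  (chi2_primitive : primitive_char q chi2) (chi2_even : even_char q chi2)
  (q_gt_1 : (1 < q)%nat)
  (c_pos : 0 < c) (beta_eq : beta = c ^ 2 * INR p * INR q / (4 * PI ^ 2))
  (beta_not_INR : forall n, (1 <= n)%nat -> INR n <> beta).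

Let p_pos : 0 < INR p.
Proof. apply lt_0_INR. lia. Qed.

Let q_pos : 0 < INR q.
Proof. apply lt_0_INR. lia. Qed.

Let beta_pos : 0 < beta.
Proof.
rewrite beta_eq. pose proof (pow_lt PI 2 PI_RGT_0). pose proof (pow_lt c 2 c_pos).
apply Rdiv_lt_0_compat; [|lra].
apply Rmult_lt_0_compat; [apply Rmult_lt_0_compat|]; assumption.
Qed.

Lemma integral_approx_dchi_K0 :
  integral_approx
    (fun u => gauss_sum p chi1 / RtoC (INR p) * twisted_poisson p (conj_char chi1) (c * exp u)
      * (gauss_sum q chi2 / RtoC (INR q) * twisted_poisson q (conj_char chi2) (c * exp (- u))))%C
    (csum (fun n => dchi chi1 chi2 n * RtoC (2 * K0 (2 * c * sqrt (INR n))))%C).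
Proof.
apply (integral_approx_dchi chi1 chi2 (fun m y => exp (- (INR m * y)))
  (fun m y => exp (- (INR m * y)))
  (fun y => gauss_sum p chi1 / RtoC (INR p) * twisted_poisson p (conj_char chi1) y)%C
  (fun y => gauss_sum q chi2 / RtoC (INR q) * twisted_poisson q (conj_char chi2) y)%C
  (fun n => n) (fun n => n) (fun n => 2 * K0 (2 * c * sqrt (INR n))) (- (2)) c c_pos).
- exact kernel_decay_exp.
- exact kernel_decay_exp.
- intros n. apply (char_Cmod_le_1 p), chi1_primitive.
- intros n. apply (char_Cmod_le_1 q), chi2_primitive.
- intros n. lia.
- intros n. lia.
- intros y Hy. now apply is_lim_twisted_exp.
- intros y Hy. now apply is_lim_twisted_exp.
- intros i j Hi Hj. rewrite mult_INR.
  apply is_RInt_line_bessel; [exact c_pos|apply lt_0_INR; lia|apply lt_0_INR; lia].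
Qed.

Lemma integral_approx_dchi_log :
  integral_approx
    (fun u => twisted_poisson p (conj_char chi1) (c * exp u)
      * twisted_poisson q (conj_char chi2) (c * exp (- u)))%C
    (csum (fun n => dchi (conj_char chi1) (conj_char chi2) n
       * RtoC (4 * beta ^ 2 / c ^ 2 * log_kernel beta (INR n)))%C).
Proof.
pose proof (dirichlet_char_conj p chi1 (proj1 chi1_primitive)) as Hc1.
pose proof (dirichlet_char_conj q chi2 (proj1 chi2_primitive)) as Hc2.
apply (integral_approx_dchi (conj_char chi1) (conj_char chi2)
  (fun n y => cauchy_kernel y (INR n / INR p)) (fun n y => cauchy_kernel y (INR n / INR q))
  (twisted_poisson p (conj_char chi1)) (twisted_poisson q (conj_char chi2))
  (Nat.mul p) (Nat.mul q)
  (fun n => 4 * beta ^ 2 / c ^ 2 * log_kernel beta (INR n)) (1 / 2) c c_pos).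
- apply kernel_decay_cauchy. lia.
- apply kernel_decay_cauchy. lia.
- intros n. now apply (char_Cmod_le_1 p).
- intros n. now apply (char_Cmod_le_1 q).
- intros n. nia.
- intros n. nia.
- intros y Hy. apply is_lim_twisted_cauchy; [|apply even_char_conj| |]; assumption.
- intros y Hy. apply is_lim_twisted_cauchy; [|apply even_char_conj| |]; assumption.
- intros i j Hi Hj.
  assert (Hi0 : 0 < INR i) by (apply lt_0_INR; lia).
  assert (Hj0 : 0 < INR j) by (apply lt_0_INR; lia).
  apply is_RInt_line_cauchy_kernel; try assumption; try now apply Rdiv_lt_0_compat.
  + rewrite beta_eq, mult_INR. pose proof PI_RGT_0. field. repeat split; lra.
  + apply beta_not_INR. nia.
Qed.

Lemma dchi_K0_log_limits :
  exists l,
    is_lim_seq_C (csum (fun n => dchi chi1 chi2 n * RtoC (2 * K0 (2 * c * sqrt (INR n))))%C)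
      (gauss_sum p chi1 / RtoC (INR p) * (gauss_sum q chi2 / RtoC (INR q)) * l)%C /\
    is_lim_seq_C (csum (fun n => dchi (conj_char chi1) (conj_char chi2) n
       * RtoC (4 * beta ^ 2 / c ^ 2 * log_kernel beta (INR n)))%C) l.
Proof.
destruct (integral_approx_lim _ _ integral_approx_dchi_log) as [l Hl].
exists l. split; [|exact Hl].
set (kappa := (gauss_sum p chi1 / RtoC (INR p) * (gauss_sum q chi2 / RtoC (INR q)))%C).
eapply integral_approx_unique.
- apply (integral_approx_Cmult kappa), integral_approx_dchi_log.
- eapply integral_approx_ext; [|exact integral_approx_dchi_K0].
  intros u. unfold kappa. ring.
- apply is_lim_seq_C_mult; [apply is_lim_seq_C_const|exact Hl].
Qed.

Lemma dchi_K0_log_series :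
  exists L M : C,
    is_series (fun n => dchi chi1 chi2 (S n) * RtoC (K0 (2 * c * sqrt (INR (S n)))))%C L /\
    is_series (fun n => dchi (conj_char chi1) (conj_char chi2) (S n)
      * RtoC (log_kernel beta (INR (S n))))%C M /\
    L = (RtoC (c ^ 2 * INR p * INR q / (8 * PI ^ 4))
         * gauss_sum p chi1 * gauss_sum q chi2 * M)%C.
Proof.
destruct dchi_K0_log_limits as [l [HK0 Hlog]]. pose proof PI_RGT_0.
set (kappa := (gauss_sum p chi1 / RtoC (INR p) * (gauss_sum q chi2 / RtoC (INR q)))%C) in HK0.
set (d := 4 * beta ^ 2 / c ^ 2) in Hlog.
assert (Hd : 0 < d).
{ pose proof (pow_lt beta 2 beta_pos). apply Rdiv_lt_0_compat; [lra|now apply pow_lt]. }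
assert (Hd0 : RtoC d <> RtoC 0) by (intros E; injection E; lra).
exists (RtoC (/ 2) * (kappa * l))%C, (RtoC (/ d) * l)%C. split; [|split].
- apply (is_series_csum_scal (RtoC (/ 2)) _
    (fun n => dchi chi1 chi2 n * RtoC (K0 (2 * c * sqrt (INR n))))%C _ HK0).
  intros n _. rewrite RtoC_mult, RtoC_inv by lra. field.
- apply (is_series_csum_scal (RtoC (/ d)) _
    (fun n => dchi (conj_char chi1) (conj_char chi2) n
      * RtoC (log_kernel beta (INR n)))%C _ Hlog).
  intros n _. rewrite RtoC_mult, RtoC_inv by lra. field. exact Hd0.
- replace (c ^ 2 * INR p * INR q / (8 * PI ^ 4)) with (/ 2 * (/ INR p * / INR q) * d)
    by (unfold d; rewrite beta_eq; field; repeat split; lra).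
  rewrite !RtoC_mult, !RtoC_inv by lra. unfold kappa. field.
  repeat split; try exact Hd0; intros E; injection E; lra.
Qed.

End VoronoiSummation.

Theorem theorem2p14 (p q : nat) (chi1 chi2 : nat -> C) (a x : R) :
  primitive_char p chi1 -> even_char p chi1 -> ~ principal p chi1 ->
  primitive_char q chi2 -> even_char q chi2 -> ~ principal q chi2 ->
  0 < a -> 0 < x ->
  (forall m : nat, (0 < m)%nat ->
     a ^ 2 * INR p * INR q * x / (16 * PI ^ 2) <> INR m) ->
  exists L M : C,
    is_series (fun n : nat =>
      (dchi chi1 chi2 (S n) * RtoC (K0 (a * sqrt (INR (S n) * x))))%C) L /\
    is_series (fun n : nat =>
      (dchi (conj_char chi1) (conj_char chi2) (S n) *
       RtoC (ln (16 * PI ^ 2 * INR (S n) / (a ^ 2 * INR p * INR q * x)) /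
             (INR (S n) ^ 2 - (a ^ 2 * INR p * INR q * x / (16 * PI ^ 2)) ^ 2)))%C) M /\
    L = (RtoC (a ^ 2 * INR p * INR q * x / (32 * PI ^ 4))
         * gauss_sum p chi1 * gauss_sum q chi2 * M)%C.
Proof.
intros Hprim1 Heven1 Hprinc1 Hprim2 Heven2 Hprinc2 Ha Hx Hbeta.
pose proof (nonprincipal_modulus_gt_1 p chi1 (proj1 Hprim1) Hprinc1) as Hp.
pose proof (nonprincipal_modulus_gt_1 q chi2 (proj1 Hprim2) Hprinc2) as Hq.
set (c := a * sqrt x / 2). set (beta := a ^ 2 * INR p * INR q * x / (16 * PI ^ 2)) in *.
assert (Hc : 0 < c) by (pose proof (sqrt_lt_R0 x Hx); unfold c; nra).
assert (Ec : a ^ 2 * INR p * INR q * x = 4 * (c ^ 2 * INR p * INR q)).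
{ unfold c. rewrite <- (pow2_sqrt x) at 1 by lra. field. }
pose proof PI_RGT_0 as HPI.
assert (Ebeta : beta = c ^ 2 * INR p * INR q / (4 * PI ^ 2))
  by (unfold beta; rewrite Ec; field; lra).
destruct (dchi_K0_log_series p q chi1 chi2 c beta Hprim1 Heven1 Hp Hprim2 Heven2 Hq Hc Ebeta)
  as [L [M [HL [HM HLM]]]]; [intros n Hn E; now apply (Hbeta n Hn)|].
exists L, M. split; [|split].
- revert HL. apply is_series_ext. intros n.
  rewrite sqrt_mult by (apply pos_INR || lra). do 3 f_equal. unfold c. field.
- revert HM. apply is_series_ext. intros n. unfold log_kernel. do 4 f_equal. unfold beta. field.
  pose proof (lt_0_INR p ltac:(lia)). pose proof (lt_0_INR q ltac:(lia)). repeat split; lra.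
- rewrite HLM, Ec. do 4 f_equal. field. lra.
Qed.
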